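(* Let $M$ be the Möbius band, i.e. the quotient of $[0,1]\times[0,1]$ by the identification $(0,t)\sim(1,1-t)$, $t\in[0,1]$. Then $M$ admits a minimal finite model with exactly four points, and it is homeomorphic to the minimal finite model of the circle $S^1$, namely the finite $T_0$-space corresponding to the poset $\{a_1,a_2,c_1,c_2\}$ whose strict order relations are exactly $c_i<a_j$ for $i,j\in\{1,2\}$.
   Context: A continuous map $f\colon X\to Y$ is a weak homotopy equivalence if it induces a bijection $\pi_0(X)\to\pi_0(Y)$ and isomorphisms $\pi_n(X,x_0)\to\pi_n(Y,f(x_0))$ for all $n\ge 1$ and every base point $x_0\in X$. Two spaces are weak homotopy equivalent if they are related by the equivalence relation generated by the existence of such a map. A finite topological space $Y$ is a finite model of a space $X$ if $Y$ is weak homotopy equivalent to $X$; it is a minimal finite model of $X$ if it has the smallest cardinality among all finite models of $X$. Finite $T_0$-spaces are identified with finite posets: the minimal open set containing $x$ is $U_x=\{y : y\le x\}$. *)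

(* Defs.v *)
From HB Require Import structures.
From mathcomp Require Import all_boot all_order all_algebra generic_quotient.
From mathcomp Require Import all_classical all_reals all_analysis.
From mathcomp Require Import homotopy.
From Stdlib Require Import Relation_Operators.

Set Implicit Arguments.
Unset Strict Implicit.
Unset Printing Implicit Defensive.

Import Order.TTheory GRing.Theory Num.Theory.
Import numFieldTopology.Exports numFieldNormedType.Exports.

Local Open Scope classical_set_scope.
Local Open Scope ring_scope.
Local Open Scope quotient_scope.
Local Open Scope card_scope.

(* Topological spaces are arbitrary [topologicalType]s, possibly empty.  The
   real numbers are any [R : realType]; since the spaces X, Y below do not
   determine R, it is an explicit argument of the homotopy notions. *)

Section UnitInterval.
Variable R : realType.

Definition unitI : set R := `[0, 1].

Lemma clampP (x : R) : Num.max 0 (Num.min 1 x) \in unitI.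
Proof.
by rewrite inE /unitI /= in_itv /= le_max lexx /= ge_max ler01 ge_min lexx.
Qed.

(* Retraction of R onto [0, 1]; below it is only a device for building points
   of [0, 1], as its argument always lies in [0, 1] where the value matters. *)
Definition clamp (x : R) : unitI := SigSub (clampP x).

Lemma val_clamp (x : R) : 0 <= x <= 1 -> set_val (clamp x) = x.
Proof.
by move=> /andP[x0 x1]; rewrite set_valE /= (min_idPr x1) (max_idPr x0).
Qed.

Lemma clamp_continuous : continuous clamp.
Proof.
apply: continuous_comp_initial => x.
have c : continuous (fun y : R => Num.max (0 : R) (Num.min 1 y)).
  apply: max_fun_continuous; first exact: cst_continuous.
  apply: min_fun_continuous; first exact: cst_continuous.
  by move=> y; exact: cvg_id.
exact: c.
Qed.

Lemma clamp01 : clamp 0 != clamp 1.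
Proof.
apply/eqP => /(congr1 set_val); rewrite !val_clamp ?lexx ?ler01//.
by move/eqP; rewrite eq_sym oner_eq0.
Qed.

HB.instance Definition _ := isBiPointed.Build (set_type unitI) clamp01.

Lemma val_zero : set_val (zero : unitI) = 0.
Proof. by rewrite val_clamp ?lexx ?ler01. Qed.

Lemma val_one : set_val (one : unitI) = 1.
Proof. by rewrite val_clamp ?lexx ?ler01. Qed.

Definition cube (n : nat) : Type := {ptws 'I_n -> unitI}.
HB.instance Definition _ n :=
  Topological.copy (cube n) {ptws 'I_n -> unitI}.

Definition cube_boundary (n : nat) : set (cube n) :=
  [set s | exists i, s i = zero \/ s i = one].

Lemma cube_continuous (Z : topologicalType) n (h : Z -> cube n) :
  (forall i, continuous (fun z => h z i)) -> continuous h.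
Proof.
move=> hc z; apply/cvg_sup => i; apply/cvg_image.
  by rewrite eqEsubset; split => y // _; exists (fun=> y).
move=> U /= nU; have := hc i z U nU; rewrite /nbhs /= => V.
exists (fun s => U (s i)) => //.
rewrite eqEsubset; split => y /=; first by case=> s ? <-.
by move=> Uy; exists (fun=> y).
Qed.

Lemma coord_continuous n (i : 'I_n) : continuous (fun s : cube n => s i).
Proof. by move=> s; exact: (@proj_continuous _ (fun=> _) i). Qed.

End UnitInterval.

Lemma pair_continuous (Z X Y : topologicalType) (f : Z -> X) (g : Z -> Y) :
  continuous f -> continuous g -> continuous (fun z => (f z, g z)).
Proof. by move=> cf cg z; exact: (cvg_pair (cf z) (cg z)). Qed.

Lemma comp_continuous (X Y Z : topologicalType) (f : X -> Y) (g : Y -> Z) :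
  continuous f -> continuous g -> continuous (fun x => g (f x)).
Proof. by move=> cf cg x; apply: continuous_comp; [exact: cf|exact: cg]. Qed.

Lemma fst_continuous (X Y : topologicalType) : continuous (@fst X Y).
Proof. by move=> p; exact: cvg_fst. Qed.

Lemma snd_continuous (X Y : topologicalType) : continuous (@snd X Y).
Proof. by move=> p; exact: cvg_snd. Qed.

Section Paste.
Variables (R : realType) (Z X : topologicalType).
Local Notation I := (set_type (@unitI R)).

Definition first_half (t : I) : I := clamp (2 * set_val t).
Definition second_half (t : I) : I := clamp (2 * set_val t - 1).

Definition paste (H K : I * Z -> X) (p : I * Z) : X :=
  if set_val p.1 <= 2^-1 then H (first_half p.1, p.2)
  else K (second_half p.1, p.2).

Lemma val01 (t : I) : 0 <= set_val t <= 1.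
Proof. by have := set_valP t; rewrite /unitI /= in_itv. Qed.

Lemma set_val_inj : injective (set_val : I -> R).
Proof. by move=> s t; rewrite set_valE; exact: val_inj. Qed.

Lemma first_half0 : first_half zero = zero.
Proof.
by apply: set_val_inj; rewrite val_clamp val_zero mulr0 // lexx ler01.
Qed.

Lemma second_half1 : second_half one = one.
Proof.
have e : 2 * 1 - 1 = 1 :> R by rewrite mulr1 -[2]/(1 + 1) addrK.
by apply: set_val_inj; rewrite val_clamp val_one e // lexx ler01.
Qed.

Lemma first_half_mid t : set_val t = 2^-1 -> first_half t = one.
Proof.
move=> tE; apply: set_val_inj; rewrite val_one /first_half tE.
by rewrite mulfV ?pnatr_eq0// val_clamp// lexx ler01.
Qed.

Lemma second_half_mid t : set_val t = 2^-1 -> second_half t = zero.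
Proof.
move=> tE; apply: set_val_inj; rewrite val_zero /second_half tE.
by rewrite mulfV ?pnatr_eq0// subrr val_clamp// lexx ler01.
Qed.

Lemma set_val_continuous : continuous (set_val : I -> R).
Proof. exact: initial_continuous. Qed.

Lemma first_half_continuous : continuous first_half.
Proof.
move=> t; apply: (@continuous_comp _ _ _ (fun t : I => 2 * set_val t)).
  apply: (@continuous_comp _ _ _ set_val); first exact: set_val_continuous.
  exact: mulrl_continuous.
exact: clamp_continuous.
Qed.

Lemma second_half_continuous : continuous second_half.
Proof.
move=> t; apply: (@continuous_comp _ _ _ (fun t : I => 2 * set_val t - 1)).
  apply: (@continuous_comp _ _ _ set_val (fun x : R => 2 * x - 1)).
    exact: set_val_continuous.
  by apply: continuousB; [exact: mulrl_continuous|exact: cst_continuous].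
exact: clamp_continuous.
Qed.

Lemma paste0 H K z : paste H K (zero, z) = H (zero, z).
Proof. by rewrite /paste /= val_zero invr_ge0 ler0n first_half0. Qed.

Lemma paste1 H K z : paste H K (one, z) = K (one, z).
Proof.
by rewrite /paste /= val_one lt_geF ?second_half1// invf_lt1// ltr1n.
Qed.

Lemma paste_continuous H K : continuous H -> continuous K ->
  (forall z, H (one, z) = K (zero, z)) -> continuous (paste H K).
Proof.
move=> cH cK HK.
pose v (p : I * Z) : R := set_val p.1.
have cv : continuous v.
  by move=> p; apply: continuous_comp; [exact: cvg_fst|exact: set_val_continuous].
pose A := v @^-1` [set x | x <= 2^-1]; pose B := v @^-1` [set x | 2^-1 <= x].
have cA : closed A by exact: closed_comp (fun p _ => cv p) (@closed_le _ _).
have cB : closed B by exact: closed_comp (fun p _ => cv p) (@closed_ge _ _).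
have AB : A `|` B = setT.
  rewrite eqEsubset; split => // p _.
  by have /orP[] := le_total (v p) (2^-1); [left|right].
have half (G : I * Z -> X) (h : I -> I) : continuous G -> continuous h ->
    continuous (fun p : I * Z => G (h p.1, p.2)).
  move=> cG ch.
  apply: (@comp_continuous _ _ _ (fun p : I * Z => (h p.1, p.2))) cG.
  apply: pair_continuous (@snd_continuous _ _).
  exact: comp_continuous (@fst_continuous _ _) ch.
apply/continuous_subspace_setT; rewrite -AB; apply: withinU_continuous => //.
  apply: (@subspace_eq_continuous _ _ _ (fun p => H (first_half p.1, p.2))).
    by move=> p /set_mem Ap; rewrite /from_subspace /paste ifT.
  by apply: continuous_subspaceT; apply: half => //; exact: first_half_continuous.
apply: (@subspace_eq_continuous _ _ _ (fun p => K (second_half p.1, p.2))).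
  move=> p /set_mem Bp; rewrite /from_subspace /paste; case: ifP => // Ap.
  have e : set_val p.1 = 2^-1 by apply/eqP; rewrite eq_le Ap; exact: Bp.
  by rewrite first_half_mid// second_half_mid.
by apply: continuous_subspaceT; apply: half => //; exact: second_half_continuous.
Qed.

End Paste.

Section PathComponents.
Variables (R : realType) (X : topologicalType).
Local Notation I := (set_type (@unitI R)).

Lemma inhabited_path (x y : X) (f : I -> X) : continuous f ->
  f zero = x -> f one = y -> inhabited {path I from x to y in X}.
Proof.
move=> cf f0 f1.
exact: (inhabits (mk_path cf f0 f1 : {path I from x to y in X})).
Qed.

Definition path_joined (x y : X) : bool :=
  `[< inhabited {path I from x to y in X} >].

Lemma path_joined_refl : reflexive path_joined.
Proof.
move=> x; apply/asboolP.
by apply: (@inhabited_path x x (fun=> x)) => //; exact: cst_continuous.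
Qed.

Lemma path_joined_sym : symmetric path_joined.
Proof.
suff s x y : path_joined x y -> path_joined y x.
  by move=> x y; apply/idP/idP; exact: s.
move=> /asboolP[p]; apply/asboolP.
apply: (@inhabited_path y x (fun t => p (clamp (1 - set_val t)))).
- apply: comp_continuous (@cts_fun _ _ p).
  apply: (@comp_continuous _ _ _ (fun t : I => 1 - set_val t)); last first.
    exact: clamp_continuous.
  apply: (@comp_continuous _ _ _ set_val (fun x : R => 1 - x)).
    exact: set_val_continuous.
  by move=> z; apply: continuousB; [exact: cst_continuous|exact: cvg_id].
- by rewrite val_zero subr0 -[clamp 1]/(one : I) path_one.
- by rewrite val_one subrr -[clamp 0]/(zero : I) path_zero.
Qed.

Lemma path_joined_trans : transitive path_joined.
Proof.
move=> y x z /asboolP[p] /asboolP[q]; apply/asboolP.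
pose f (t : I) := paste (fun u : I * I => p u.1) (fun u => q u.1) (t, t).
apply: (@inhabited_path x z f).
- apply: (@comp_continuous _ _ _ (fun t : I => (t, t))).
    by apply: pair_continuous => t; exact: cvg_id.
  apply: paste_continuous.
  + exact: comp_continuous (@fst_continuous _ _) (@cts_fun _ _ p).
  + exact: comp_continuous (@fst_continuous _ _) (@cts_fun _ _ q).
  + by move=> z'; rewrite /= path_one path_zero.
- by rewrite /f paste0 path_zero.
- by rewrite /f paste1 path_one.
Qed.

Definition path_joined_equiv := EquivRel path_joined
  path_joined_refl path_joined_sym path_joined_trans.

Definition pi0 := {eq_quot path_joined_equiv}.

Lemma pi0_eqP (x y : X) : reflect (inhabited {path I from x to y in X})
  (\pi_pi0 x == \pi_pi0 y).
Proof. by rewrite eqmodE; exact: asboolP. Qed.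

End PathComponents.

Section Pi0Map.
Variables (R : realType) (X Y : topologicalType) (phi : continuousType X Y).

(* Maps out of a quotient are defined on the chosen representative [repr c];
   here and below, the companion lemma ending in [_pi] shows that the result
   does not depend on that choice. *)
Definition pi0_map (c : pi0 R X) : pi0 R Y := \pi_(pi0 R Y) (phi (repr c)).

Lemma pi0_map_pi x : pi0_map (\pi_(pi0 R X) x) = \pi_(pi0 R Y) (phi x).
Proof.
apply/eqP/pi0_eqP.
have /pi0_eqP[p] : \pi_(pi0 R X) (repr (\pi_(pi0 R X) x)) == \pi_(pi0 R X) x.
  by rewrite reprK.
apply: (@inhabited_path _ _ _ _ (phi \o p)); rewrite /= ?path_zero ?path_one//.
exact: comp_continuous (@cts_fun _ _ p) (@cts_fun _ _ phi).
Qed.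

End Pi0Map.

Section Loops.
Variables (R : realType) (n : nat) (X : topologicalType) (x0 : X).
Local Notation I := (set_type (@unitI R)).

Record gloop := Gloop {
  gloop_fun :> cube R n -> X;
  gloop_continuous : continuous gloop_fun;
  gloop_boundary : forall s, cube_boundary s -> gloop_fun s = x0 }.

HB.instance Definition _ := gen_eqMixin gloop.
HB.instance Definition _ := gen_choiceMixin gloop.

Definition loop_homotopy (f g : gloop) (H : I * cube R n -> X) : Prop :=
  [/\ continuous H,
      forall s, H (zero, s) = f s,
      forall s, H (one, s) = g s &
      forall t s, cube_boundary s -> H (t, s) = x0].

Definition loop_homotopic (f g : gloop) : bool :=
  `[< exists H, loop_homotopy f g H >].

Lemma loop_homotopic_refl : reflexive loop_homotopic.
Proof.
move=> f; apply/asboolP; exists (fun p => f p.2); split => //.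
  exact: comp_continuous (@snd_continuous _ _) (@gloop_continuous f).
by move=> t s; exact: gloop_boundary.
Qed.

Lemma loop_homotopic_sym : symmetric loop_homotopic.
Proof.
suff s f g : loop_homotopic f g -> loop_homotopic g f.
  by move=> f g; apply/idP/idP; exact: s.
move=> /asboolP[H [cH H0 H1 Hb]]; apply/asboolP.
exists (fun p => H (clamp (1 - set_val p.1), p.2)); split.
- apply: (@comp_continuous _ _ _
      (fun p : I * cube R n => (clamp (1 - set_val p.1), p.2))) cH.
  apply: pair_continuous (@snd_continuous _ _).
  apply: (@comp_continuous _ _ _ fst (fun t : I => clamp (1 - set_val t))).
    exact: fst_continuous.
  apply: (@comp_continuous _ _ _ (fun t : I => 1 - set_val t)); last first.
    exact: clamp_continuous.
  apply: (@comp_continuous _ _ _ set_val (fun x : R => 1 - x)).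
    exact: set_val_continuous.
  by move=> z; apply: continuousB; [exact: cst_continuous|exact: cvg_id].
- by move=> s /=; rewrite val_zero subr0 -[clamp 1]/(one : I) H1.
- by move=> s /=; rewrite val_one subrr -[clamp 0]/(zero : I) H0.
- by move=> t s /Hb ->.
Qed.

Lemma loop_homotopic_trans : transitive loop_homotopic.
Proof.
move=> g f h /asboolP[H [cH H0 H1 Hb]] /asboolP[K [cK K0 K1 Kb]].
apply/asboolP; exists (paste H K); split.
- by apply: paste_continuous => // s; rewrite H1 K0.
- by move=> s; rewrite paste0 H0.
- by move=> s; rewrite paste1 K1.
- by move=> t s bs; rewrite /paste /=; case: ifP => _; [exact: Hb|exact: Kb].
Qed.

Definition loop_homotopic_equiv := EquivRel loop_homotopic
  loop_homotopic_refl loop_homotopic_sym loop_homotopic_trans.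

Definition htpy_group := {eq_quot loop_homotopic_equiv}.

Lemma pi_eqP (f g : gloop) :
  reflect (exists H, loop_homotopy f g H) (\pi_htpy_group f == \pi_htpy_group g).
Proof. by rewrite eqmodE; exact: asboolP. Qed.

Lemma pi_repr_homotopic (f : gloop) :
  exists H, loop_homotopy (repr (\pi_htpy_group f)) f H.
Proof. by apply/pi_eqP; rewrite reprK. Qed.

End Loops.

Section Concatenation.
Variables (R : realType) (n : nat) (X : topologicalType) (x0 : X).
Local Notation I := (set_type (@unitI R)).
Local Notation loop := (gloop R n.+1 x0).

Definition set_coord0 (t : I) (s : cube R n.+1) : cube R n.+1 :=
  fun i => if i == ord0 then t else s i.

Lemma set_coord0_continuous (Z : topologicalType) (a : Z -> I)
    (b : Z -> cube R n.+1) : continuous a -> continuous b ->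
  continuous (fun z => set_coord0 (a z) (b z)).
Proof.
move=> ca cb; apply: cube_continuous => i; rewrite /set_coord0.
case: eqP => // _; apply: (@comp_continuous _ _ _ b (fun s => s i)) => //.
exact: coord_continuous.
Qed.

Lemma set_coord0_boundary t s :
  t = zero \/ t = one -> cube_boundary (set_coord0 t s).
Proof. by exists ord0; rewrite /set_coord0 eqxx. Qed.

Definition concat_fun (f g : cube R n.+1 -> X) (s : cube R n.+1) : X :=
  if set_val (s ord0) <= 2^-1
  then f (set_coord0 (first_half (s ord0)) s)
  else g (set_coord0 (second_half (s ord0)) s).

Lemma concat_boundary (f g : cube R n.+1 -> X) :
  (forall s, cube_boundary s -> f s = x0) ->
  (forall s, cube_boundary s -> g s = x0) ->
  forall s, cube_boundary s -> concat_fun f g s = x0.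
Proof.
move=> fb gb s [i si]; rewrite /concat_fun.
have [i0|i0] := eqVneq i ord0; last first.
  by case: ifP => _; [apply: fb|apply: gb]; exists i;
    rewrite /set_coord0 (negbTE i0).
rewrite {}i0 in si; case: si => ->.
  rewrite val_zero invr_ge0 ler0n first_half0.
  by apply: fb; apply: set_coord0_boundary; left.
rewrite val_one lt_geF ?invf_lt1 ?ltr1n// second_half1.
by apply: gb; apply: set_coord0_boundary; right.
Qed.

Lemma concat_homotopy_continuous (Z : topologicalType)
    (H K : Z * cube R n.+1 -> X) :
  continuous H -> continuous K ->
  (forall z s, cube_boundary s -> H (z, s) = x0) ->
  (forall z s, cube_boundary s -> K (z, s) = x0) ->
  continuous (fun p =>
    concat_fun (fun s => H (p.1, s)) (fun s => K (p.1, s)) p.2).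
Proof.
move=> cH cK Hb Kb.
pose e (p : I * (Z * cube R n.+1)) := (p.2.1, set_coord0 p.1 p.2.2).
have ce : continuous e.
  apply: pair_continuous.
    exact: comp_continuous (@snd_continuous _ _) (@fst_continuous _ _).
  apply: set_coord0_continuous; first exact: fst_continuous.
  exact: comp_continuous (@snd_continuous _ _) (@snd_continuous _ _).
apply: (@comp_continuous _ _ _
  (fun p : Z * cube R n.+1 => (p.2 ord0, p)) (paste (H \o e) (K \o e))).
  apply: pair_continuous; last by move=> p; exact: cvg_id.
  apply: (@comp_continuous _ _ _ snd (fun s : cube R n.+1 => s ord0)).
    exact: snd_continuous.
  exact: coord_continuous.
apply: paste_continuous.
- exact: (@comp_continuous _ _ _ e H ce cH).
- exact: (@comp_continuous _ _ _ e K ce cK).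
- move=> [z s] /=; rewrite /e /= Hb ?Kb//; apply: set_coord0_boundary.
    by left.
  by right.
Qed.

Lemma concat_continuous (f g : loop) : continuous (concat_fun f g).
Proof.
have lift (h : loop) : continuous (fun p : I * cube R n.+1 => h p.2).
  exact: comp_continuous (@snd_continuous _ _) (@gloop_continuous _ _ _ _ h).
have := concat_homotopy_continuous (lift f) (lift g)
  (fun _ => @gloop_boundary _ _ _ _ f) (fun _ => @gloop_boundary _ _ _ _ g).
apply: (@comp_continuous _ _ _ (fun s => (zero, s))).
by apply: pair_continuous => s; [exact: cst_continuous|exact: cvg_id].
Qed.

Definition concat (f g : loop) : loop := Gloop (@concat_continuous f g)
  (concat_boundary (@gloop_boundary _ _ _ _ f) (@gloop_boundary _ _ _ _ g)).

Definition pi_mul (a b : htpy_group R n.+1 x0) : htpy_group R n.+1 x0 :=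
  \pi_(htpy_group R n.+1 x0) (concat (repr a) (repr b)).

Lemma pi_mul_pi (f g : loop) :
  pi_mul (\pi_(htpy_group R n.+1 x0) f) (\pi_(htpy_group R n.+1 x0) g) =
  \pi_(htpy_group R n.+1 x0) (concat f g).
Proof.
apply/eqP/pi_eqP.
have [H [cH H0 H1 Hb]] := pi_repr_homotopic f.
have [K [cK K0 K1 Kb]] := pi_repr_homotopic g.
exists (fun p => concat_fun (fun s => H (p.1, s)) (fun s => K (p.1, s)) p.2).
split.
- exact: concat_homotopy_continuous.
- by move=> s; rewrite /= /concat_fun H0 K0.
- by move=> s; rewrite /= /concat_fun H1 K1.
- by move=> t s bs; apply: concat_boundary bs => u; [exact: Hb|exact: Kb].
Qed.

End Concatenation.

Section PiMap.
Variables (R : realType) (X Y : topologicalType) (phi : continuousType X Y).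
Variables (n : nat) (x0 : X).

Lemma loop_map_boundary (f : gloop R n x0) s :
  cube_boundary s -> phi (f s) = phi x0.
Proof. by move/(@gloop_boundary _ _ _ _ f) ->. Qed.

Definition loop_map (f : gloop R n x0) : gloop R n (phi x0) :=
  Gloop (comp_continuous (@gloop_continuous _ _ _ _ f) (@cts_fun _ _ phi))
        (@loop_map_boundary f).

Definition pi_map (c : htpy_group R n x0) : htpy_group R n (phi x0) :=
  \pi_(htpy_group R n (phi x0)) (loop_map (repr c)).

Lemma pi_map_pi (f : gloop R n x0) :
  pi_map (\pi_(htpy_group R n x0) f) = \pi_(htpy_group R n (phi x0)) (loop_map f).
Proof.
apply/eqP/pi_eqP; have [H [cH H0 H1 Hb]] := pi_repr_homotopic f.
exists (fun p => phi (H p)); split.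
- exact: comp_continuous cH (@cts_fun _ _ phi).
- by move=> s; rewrite /= H0.
- by move=> s; rewrite /= H1.
- by move=> t s /Hb ->.
Qed.

End PiMap.

(* The cases n >= 1 are indexed by n.+1; an isomorphism of homotopy groups is a
   bijection compatible with the group laws. *)
Definition weak_homotopy_equivalence (R : realType) (X Y : topologicalType)
    (phi : continuousType X Y) : Prop :=
  bijective (@pi0_map R X Y phi) /\
  forall (n : nat) (x0 : X),
    bijective (@pi_map R X Y phi n.+1 x0) /\
    {morph @pi_map R X Y phi n.+1 x0 : a b / pi_mul a b}.

Definition weakly_equivalent (R : realType) (Y X : topologicalType) : Prop :=
  clos_refl_sym_trans topologicalType
    (fun A B => exists phi : continuousType A B,
       weak_homotopy_equivalence R phi) Y X.

Definition finite_model (R : realType) (Y X : topologicalType) : Prop :=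
  finite_set [set: Y] /\ weakly_equivalent R Y X.

Definition minimal_finite_model (R : realType) (Y X : topologicalType) : Prop :=
  finite_model R Y X /\
  forall Z : topologicalType, finite_model R Z X -> [set: Y] #<= [set: Z].

Definition homeomorphic (X Y : topologicalType) : Prop :=
  exists (f : X -> Y) (g : Y -> X),
    [/\ continuous f, continuous g, cancel f g & cancel g f].

Definition circle (R : realType) : topologicalType :=
  set_type [set p : R * R | p.1 ^+ 2 + p.2 ^+ 2 = 1].

Section Moebius.
Variable R : realType.
Local Notation I := (set_type (@unitI R)).

Definition moebius_glue (p q : I * I) : Prop :=
  [/\ p.1 = zero, q.1 = one & set_val q.2 = 1 - set_val p.2].

Definition moebius_rel (p q : I * I) : bool :=
  `[< clos_refl_sym_trans (I * I) moebius_glue p q >].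

Lemma moebius_rel_refl : reflexive moebius_rel.
Proof. by move=> p; apply/asboolP; exact: rst_refl. Qed.

Lemma moebius_rel_sym : symmetric moebius_rel.
Proof.
by move=> p q; apply/asboolP/asboolP => /(@rst_sym (I * I) moebius_glue).
Qed.

Lemma moebius_rel_trans : transitive moebius_rel.
Proof.
by move=> q p r /asboolP pq /asboolP qr; apply/asboolP; exact: rst_trans pq qr.
Qed.

Definition moebius_equiv :=
  EquivRel moebius_rel moebius_rel_refl moebius_rel_sym moebius_rel_trans.

Definition moebius_band : topologicalType :=
  quotient_topology {eq_quot moebius_equiv}.

End Moebius.

(* The poset P with the down-sets as open sets, so that the minimal open set
   containing x is { y | y <= x }. *)
Section Alexandrov.
Context {d : Order.disp_t} {P : porderType d}.

Definition alexandrov : Type := P.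
HB.instance Definition _ := Choice.on alexandrov.

Definition down_set (U : set alexandrov) : Prop :=
  forall x y : P, (y <= x)%O -> U x -> U y.

Lemma down_setT : down_set setT.
Proof. by []. Qed.

Lemma down_setI U V : down_set U -> down_set V -> down_set (U `&` V).
Proof. by move=> dU dV x y yx [Ux Vx]; split; [exact: dU Ux|exact: dV Vx]. Qed.

Lemma down_set_bigcup (J : Type) (U : J -> set alexandrov) :
  (forall j, down_set (U j)) -> down_set (\bigcup_j U j).
Proof. by move=> dU x y yx [j _ Ujx]; exists j => //; exact: dU Ujx. Qed.

HB.instance Definition _ :=
  isOpenTopological.Build alexandrov down_setT down_setI down_set_bigcup.

End Alexandrov.
Arguments alexandrov {d} P.

Variant crown := A1 | A2 | C1 | C2.

Definition crown_code (x : crown) : bool * bool :=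
  match x with
  | A1 => (true, false) | A2 => (true, true)
  | C1 => (false, false) | C2 => (false, true)
  end.

Definition crown_decode (b : bool * bool) : crown :=
  match b with
  | (true, false) => A1 | (true, true) => A2
  | (false, false) => C1 | (false, true) => C2
  end.

Lemma crown_codeK : cancel crown_code crown_decode.
Proof. by case. Qed.

HB.instance Definition _ := Finite.copy crown (can_type crown_codeK).

Definition crown_lt (x y : crown) : bool :=
  match x, y with
  | C1, A1 | C1, A2 | C2, A1 | C2, A2 => true
  | _, _ => false
  end.

Lemma crown_lt_irr : irreflexive crown_lt.
Proof. by case. Qed.

Lemma crown_lt_trans : transitive crown_lt.
Proof. by do 3!case. Qed.

Fact crown_display : Order.disp_t.
Proof. exact: Order.Disp tt tt. Qed.

HB.instance Definition _ :=
  Order.Lt_isPOrder.Build crown_display crown crown_lt_irr crown_lt_trans.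

Definition crown_space : topologicalType := alexandrov crown.

(* Main.v *)
Require Import Defs.
From HB Require Import structures.
From mathcomp Require Import all_boot all_order all_algebra generic_quotient.
From mathcomp Require Import all_classical all_reals all_analysis.
From mathcomp Require Import homotopy ring lra.
From Stdlib Require Import Relation_Operators.

(** The quotient map from the circle to the crown sends two antipodal points to
    [A1], [A2] and the two open arcs between them to [C1], [C2].  A map [g] from a
    metrizable space to the crown lifts exactly through it: the first coordinate
    of the lift may be any function into [-1, 1] whose fibres over 1 and -1 are
    the closed sets [g = A1] and [g = A2], and [g] dictates the sign of the second
    coordinate.  Two lifts of the same map are joined by interpolating first
    coordinates, so the quotient map is a weak equivalence.  The Moebius band
    retracts by deformation onto its core circle.

    Path connectedness and triviality of all fundamental groups are invariant
    under weak equivalence.  A path connected space with at most four points is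
    either the crown or contractible in two steps, each given by maps comparable
    in the specialization order, a finite check.  The circle is not
    simply connected: along a homotopy of loops, having a square root that is a
    loop is an open and closed condition, which holds for constant loops but
    fails for the loop of degree one. *)

Set Implicit Arguments.
Unset Strict Implicit.
Unset Printing Implicit Defensive.

Import Order.TTheory GRing.Theory Num.Theory.
Import numFieldTopology.Exports numFieldNormedType.Exports.

Local Open Scope classical_set_scope.
Local Open Scope ring_scope.
Local Open Scope quotient_scope.
Local Open Scope card_scope.

(** Both formulas are continuous on the whole space and only their agreement with [h] is local, so
    the branches of an [if] can be used as they stand. *)
Lemma closed_cover_continuous (X Y : topologicalType) (A B : set X)
    (f g h : X -> Y) : closed A -> closed B -> (forall x, A x \/ B x) ->
  continuous f -> continuous g ->
  (forall x, A x -> h x = f x) -> (forall x, B x -> h x = g x) -> continuous h.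
Proof.
move=> cA cB AB cf cg hf hg.
have ABT : A `|` B = setT by rewrite eqEsubset; split => // x _; exact: AB.
apply/continuous_subspace_setT; rewrite -ABT; apply: withinU_continuous => //.
  apply: (@subspace_eq_continuous _ _ _ f); last exact: continuous_subspaceT.
  by move=> x /set_mem Ax; rewrite /from_subspace hf.
apply: (@subspace_eq_continuous _ _ _ g); last exact: continuous_subspaceT.
by move=> x /set_mem Bx; rewrite /from_subspace hg.
Qed.

(** * Continuity of real-valued expressions *)

Section RealValued.
Variables (R : realType) (X : topologicalType).
Implicit Types f g : X -> R.

Lemma addf_continuous f g : continuous f -> continuous g ->
  continuous (fun x => f x + g x).
Proof. by move=> cf cg x; apply: continuousD; [exact: cf|exact: cg]. Qed.

Lemma oppf_continuous f : continuous f -> continuous (fun x => - f x).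
Proof. by move=> cf x; apply: continuousN; exact: cf. Qed.

Lemma mulf_continuous f g : continuous f -> continuous g ->
  continuous (fun x => f x * g x).
Proof. by move=> cf cg x; apply: continuousM; [exact: cf|exact: cg]. Qed.

Lemma invf_continuous f : continuous f -> (forall x, f x != 0) ->
  continuous (fun x => (f x)^-1).
Proof. by move=> cf f0 x; apply: continuousV; [exact: f0|exact: cf]. Qed.

Lemma minf_continuous f g : continuous f -> continuous g ->
  continuous (fun x => Num.min (f x) (g x)).
Proof. exact: min_fun_continuous. Qed.

Lemma normf_continuous f : continuous f -> continuous (fun x => `|f x|).
Proof.
by move=> cf; apply: comp_continuous cf _ => x; exact: norm_continuous.
Qed.

Lemma sqrtf_continuous f : continuous f -> continuous (fun x => Num.sqrt (f x)).
Proof.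
by move=> cf; apply: comp_continuous cf _; exact: sqrt_continuous.
Qed.

Lemma clampf_continuous f : continuous f -> continuous (fun x => clamp (f x)).
Proof. by move=> cf; apply: comp_continuous cf _; exact: clamp_continuous. Qed.

Lemma set_valf_continuous (f : X -> set_type (@unitI R)) : continuous f ->
  continuous (fun x => set_val (f x) : R).
Proof. by move=> cf; apply: comp_continuous cf _; exact: set_val_continuous. Qed.

Lemma fstf_continuous (Y Z : topologicalType) (f : X -> Y * Z) :
  continuous f -> continuous (fun x => (f x).1).
Proof. by move=> cf; apply: comp_continuous cf _; exact: fst_continuous. Qed.

Lemma sndf_continuous (Y Z : topologicalType) (f : X -> Y * Z) :
  continuous f -> continuous (fun x => (f x).2).
Proof. by move=> cf; apply: comp_continuous cf _; exact: snd_continuous. Qed.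

Lemma id_continuous : continuous (fun x : X => x).
Proof. by move=> x; exact: cvg_id. Qed.

Lemma const_continuous (Y : topologicalType) (y : Y) :
  continuous (fun _ : X => y).
Proof. exact: cst_continuous. Qed.

Lemma pair_const_continuous (Y : topologicalType) (y : Y) :
  continuous (fun x : X => (y, x)).
Proof.
by apply: pair_continuous; [exact: const_continuous|exact: id_continuous].
Qed.

Lemma coordf_continuous n (f : X -> cube R n) i : continuous f ->
  continuous (fun x => f x i).
Proof.
move=> cf; apply: (@comp_continuous _ _ _ f (fun s : cube R n => s i)) => //.
exact: Defs.coord_continuous.
Qed.

End RealValued.

(** Recursion on the shape of the function. Powers and varying inverses have no case of their own:
    squares are expanded into products beforehand, and the continuity of such an inverse is taken
    from the context. *)
Ltac continuity :=
  lazymatch goal with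
  | |- forall z, continuous_at z ?f =>
    lazymatch f with
    | (fun x => x) => exact: id_continuous
    | fst => exact: fst_continuous
    | snd => exact: snd_continuous
    | (fun _ => ?c) => exact: const_continuous
    | (fun x => (@?a x, @?b x)) =>
        apply: (@pair_continuous _ _ _ a b); continuity
    | (fun x => clamp (@?a x)) => apply: (@clampf_continuous _ _ a); continuity
    | (fun x => set_val (@?a x)) =>
        apply: (@set_valf_continuous _ _ a); continuity
    | (fun x => @?a x + @?b x) =>
        apply: (@addf_continuous _ _ a b); continuity
    | (fun x => - @?a x) => apply: (@oppf_continuous _ _ a); continuity
    | (fun x => @?a x * @?b x) =>
        apply: (@mulf_continuous _ _ a b); continuity
    | (fun x => Num.min (@?a x) (@?b x)) =>
        apply: (@minf_continuous _ _ a b); continuity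
    | (fun x => `|@?a x|) => apply: (@normf_continuous _ _ a); continuity
    | (fun x => Num.sqrt (@?a x)) => apply: (@sqrtf_continuous _ _ a); continuity
    | (fun x => (@?a x).1) => apply: (@fstf_continuous _ _ _ a); continuity
    | (fun x => (@?a x).2) => apply: (@sndf_continuous _ _ _ a); continuity
    | pair ?c => exact: pair_const_continuous
    | @clamp _ => exact: clamp_continuous
    | _ => try assumption
    end
  end.

(** * Null-homotopic loops *)

Section Squares.
Variable R : realType.
Local Notation I := (set_type (@unitI R)).

Lemma clampK (t : I) : clamp (set_val t) = t.
Proof. by apply: set_val_inj; rewrite val_clamp// val01. Qed.

Lemma clamp_le0 (x : R) : x <= 0 -> clamp x = zero.
Proof.
move=> x0; apply: set_val_inj; rewrite val_zero /clamp set_valE /=.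
by apply/max_idPl; rewrite ge_min x0 orbT.
Qed.

Lemma clamp_ge1 (x : R) : 1 <= x -> clamp x = one.
Proof.
move=> x1; apply: set_val_inj; rewrite val_one /clamp set_valE /=.
by rewrite (min_idPl x1); apply/max_idPr; exact: ler01.
Qed.

(** Based homotopies written on a square, which is easier to reparametrize than the product of [I]
    with a one-dimensional cube; [pi1_trivialP] translates. *)
Definition null_loop (X : topologicalType) (l : I -> X) : Prop :=
  exists K : I * I -> X, [/\ continuous K, forall s, K (zero, s) = l s,
    forall s, K (one, s) = l zero,
    forall t, K (t, zero) = l zero & forall t, K (t, one) = l zero].

(* Pushing the left edge of the square across onto the other three sides turns
   the loop [K (zero, -)] into a path followed by its inverse. *)
Lemma freely_null_loop (X : topologicalType) (K : I * I -> X) :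
  continuous K -> (forall t, K (t, zero) = K (t, one)) ->
  (forall s, K (one, s) = K (one, zero)) ->
  null_loop (fun s => K (zero, s)).
Proof.
move=> cK K01 K1.
(* The path [(tau, sg)] follows the other three sides, one per third of [0, 1]: [tau] rises to 1
   with [sg] at 0, then [sg] rises to 1 with [tau] at 1, then [tau] falls back to 0. [A]
   interpolates from the left edge to this path, and [B] shrinks what remains along the edge where
   the second coordinate is 0. *)
pose tau (s : I) : R := Num.min 1 (Num.min (3 * set_val s) (3 - 3 * set_val s)).
pose sg (s : I) : R := set_val (clamp (3 * set_val s - 1)).
pose A (p : I * I) := K (clamp (set_val p.1 * tau p.2),
  clamp ((1 - set_val p.1) * set_val p.2 + set_val p.1 * sg p.2)).
pose B (p : I * I) := K (clamp ((1 - set_val p.1) * tau p.2), zero).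
have tau0 : tau zero = 0.
  by apply/le_anti; rewrite /tau val_zero !ge_min !le_min; apply/andP; split; lra.
have tau1 : tau one = 0.
  by apply/le_anti; rewrite /tau val_one !ge_min !le_min; apply/andP; split; lra.
have sg0 : sg zero = 0.
  by rewrite /sg val_zero mulr0 sub0r clamp_le0 ?val_zero//; lra.
have sg1 : sg one = 1.
  by rewrite /sg val_one mulr1 clamp_ge1 ?val_one//; lra.
have cl0 : clamp 0 = zero :> I by rewrite clamp_le0.
have cl1 : clamp 1 = one :> I by rewrite clamp_ge1.
have cA : continuous A.
  by apply: (comp_continuous _ cK); rewrite /tau /sg; continuity.
have cB : continuous B.
  by apply: (comp_continuous _ cK); rewrite /tau; continuity.
(* On the first third [sg] is 0; on the last it is 1, and [K] agrees on these two edges; in between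
   [tau] is 1, where [K] is constant. *)
have AB s : A (one, s) = B (zero, s).
  rewrite /A /B /= val_one val_zero subr0 subrr mul0r add0r !mul1r.
  have [s1|s1] := leP (set_val s) (3^-1).
    by rewrite [clamp (sg s)]clamp_le0// /sg clamp_le0 ?val_zero//; lra.
  have [s2|s2] := leP (2/3) (set_val s).
    by rewrite K01 [clamp (sg s)]clamp_ge1// /sg clamp_ge1 ?val_one//; lra.
  rewrite [clamp (tau s)]clamp_ge1 ?K1// /tau.
  by rewrite !le_min lexx /=; apply/andP; split; lra.
exists (paste A B); split.
- exact: paste_continuous.
- move=> s; rewrite paste0 /A /= val_zero !mul0r subr0 mul1r addr0 cl0.
  by rewrite clampK.
- by move=> s; rewrite paste1 /B /= val_one subrr mul0r cl0.
- move=> t; rewrite /paste /A /B /=; case: ifP => _.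
    by rewrite tau0 sg0 val_zero !mulr0 addr0 cl0.
  by rewrite tau0 mulr0 cl0.
- move=> t; rewrite /paste /A /B /=; case: ifP => _.
    by rewrite tau1 sg1 val_one !mulr1 !mulr0 subrK cl0 cl1 -K01.
  by rewrite tau1 mulr0 cl0.
Qed.

Definition pi1_trivial (X : topologicalType) (x : X) : Prop :=
  forall f g : gloop R 1 x, loop_homotopic f g.

Lemma pi1_trivialP (X : topologicalType) (x : X) : pi1_trivial x <->
  forall l : I -> X, continuous l -> l zero = x -> l one = x -> null_loop l.
Proof.
split=> [tr l cl l0 l1|tr].
  have cf : continuous (fun s : cube R 1 => l (s ord0)).
    by apply: (comp_continuous _ cl); exact: Defs.coord_continuous.
  have bf (s : cube R 1) : cube_boundary s -> l (s ord0) = x.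
    by case=> i; rewrite (ord1 i) => -[->|->].
  have bc (s : cube R 1) : cube_boundary s -> x = x by [].
  have /asboolP[H [cH H0 H1 Hb]] :=
    tr (Gloop cf bf) (Gloop (@const_continuous _ _ x) bc).
  exists (fun p => H (p.1, fun=> p.2)); split => /=.
  - apply: (comp_continuous _ cH).
    apply: pair_continuous; first by continuity.
    by apply: cube_continuous => i; continuity.
  - by move=> s; rewrite H0.
  - by move=> s; rewrite H1 /= l0.
  - by move=> t; rewrite l0 Hb//; exists ord0; left.
  - by move=> t; rewrite l0 Hb//; exists ord0; right.
suff N (f : gloop R 1 x) : loop_homotopic f
    (Gloop (@const_continuous _ _ x) (fun _ (_ : cube_boundary _) => erefl)).
  move=> f g; apply: (loop_homotopic_trans (N f)).
  by rewrite loop_homotopic_sym.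
have cc : continuous (fun t : I => (fun=> t) : cube R 1).
  by apply: cube_continuous => i; continuity.
have f0 : f (fun=> zero) = x by apply: gloop_boundary; exists ord0; left.
have f1 : f (fun=> one) = x by apply: gloop_boundary; exists ord0; right.
have [|//|//|K [cK K0 K1 Kz Ko]] := tr (fun t => f (fun=> t)).
  by apply: (comp_continuous cc); exact: gloop_continuous.
have eta (s : cube R 1) : (fun=> s ord0) = s.
  by apply/funext => i; rewrite (ord1 i).
apply/asboolP; exists (fun p => K (p.1, p.2 ord0)); split => /=.
- apply: (comp_continuous _ cK); continuity.
  by apply: coordf_continuous; continuity.
- by move=> s; rewrite K0 eta.
- by move=> s; rewrite K1 f0.
- by move=> t s [i]; rewrite (ord1 i) => -[->|->]; rewrite ?Kz ?Ko f0.
Qed.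

(** The loop is dragged along the path to a loop at [x] and contracted there. The base point moves
    meanwhile, so [freely_null_loop] is needed to conclude. *)
Lemma pi1_trivial_path (X : topologicalType) (x y : X) :
  path_joined R x y -> pi1_trivial x -> pi1_trivial y.
Proof.
move=> /asboolP[g] /pi1_trivialP trx; apply/pi1_trivialP => l cl l0 l1.
have cg : continuous g := @cts_fun _ _ g.
have g0 : g zero = x by exact: path_zero.
have g1 : g one = y by exact: path_one.
(* [e] runs through [g] on [-1, 0], [l] on [0, 1] and the reverse of [g] on [1, 2]. *)
pose e0 (r : R) := if r <= 1 then l (clamp r) else g (clamp (2 - r)).
pose e (r : R) := if r <= 0 then g (clamp (1 + r)) else e0 r.
have ce0 : continuous e0.
  apply: (closed_cover_continuous (@closed_le _ 1) (@closed_ge _ 1)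
    (f := fun r => l (clamp r)) (g := fun r => g (clamp (2 - r)))).
  - by move=> r /=; apply/orP; exact: le_total.
  - by apply: (comp_continuous _ cl); continuity.
  - by apply: (comp_continuous _ cg); continuity.
  - by move=> r /= r1; rewrite /e0 r1.
  - move=> r /= r1; rewrite /e0; case: ifP => // r1'.
    by rewrite !clamp_ge1 ?l1 ?g1//; lra.
have ce : continuous e.
  have cgc : continuous (fun r : R => g (clamp (1 + r))).
    by apply: (comp_continuous _ cg); continuity.
  apply: (closed_cover_continuous (@closed_le _ 0) (@closed_ge _ 0) _ cgc ce0).
  - by move=> r /=; apply/orP; exact: le_total.
  - by move=> r /= r1; rewrite /e r1.
  - move=> r /= r0; rewrite /e; case: ifP => // r0'.
    have -> : r = 0 by lra.
    by rewrite /e0 ler01 addr0 clamp_ge1// g1 clamp_le0 ?l0.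
(* At time [t] the loop traverses [e] over [-t, 1 + t], so its two ends stay equal while they move
   along [g] from [y] back to [x]. *)
pose K1 (p : I * I) :=
  e (- set_val p.1 + set_val p.2 * (1 + 2 * set_val p.1)).
have cK1 : continuous K1 by apply: (comp_continuous _ ce); continuity.
have K1z t : K1 (t, zero) = g (clamp (1 - set_val t)).
  rewrite /K1 /= val_zero mul0r addr0 /e ifT//.
  by have := val01 t; lra.
have K1o t : K1 (t, one) = g (clamp (1 - set_val t)).
  rewrite /K1 /= val_one mul1r.
  have -> : - set_val t + (1 + 2 * set_val t) = 1 + set_val t by ring.
  have t01 := val01 t; rewrite /e ifF; last by apply/negbTE; rewrite -ltNge; lra.
  rewrite /e0; case: ifP => [t0|_]; last by congr (g (clamp _)); ring.
  by rewrite !clamp_ge1 ?l1 ?g1//; lra.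
have K10 s : K1 (zero, s) = l s.
  have s01 := val01 s.
  rewrite /K1 /= val_zero oppr0 add0r mulr0 addr0 mulr1 /e.
  case: ifP => [s0|_].
    have -> : s = zero by apply: set_val_inj; rewrite val_zero; lra.
    by rewrite val_zero addr0 clamp_ge1// g1 l0.
  by rewrite /e0 ifT ?clampK//; lra.
have [K2 [cK2 K20 K21 K2z K2o]] : null_loop (fun s => K1 (one, s)).
  apply: trx; first by apply: (comp_continuous _ cK1); continuity.
    by rewrite K1z val_one subrr clamp_le0.
  by rewrite K1o val_one subrr clamp_le0.
have := @freely_null_loop _ (paste K1 K2) (paste_continuous cK1 cK2 _).
have -> : (fun s => paste K1 K2 (zero, s)) = l.
  by apply/funext => s; rewrite paste0.
apply.
- by move=> z; rewrite K20.
- by move=> t; rewrite /paste /=; case: ifP => _; rewrite ?K1z ?K1o ?K2z ?K2o.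
- by move=> s; rewrite !paste1 !K21.
Qed.

End Squares.

Lemma inj_surj_bijective (A B : Type) (f : A -> B) :
  injective f -> (forall y, exists x, f x = y) -> bijective f.
Proof.
move=> injf surjf; exists (fun y => projT1 (cid (surjf y))) => [x|y].
  by apply: injf; case: cid.
by case: cid.
Qed.

(** * Invariants of weak equivalence *)

Section WeakEquivalences.
Variable R : realType.
Local Notation I := (set_type (@unitI R)).

(** This form makes the space nonempty, which later provides a default point. *)
Definition path_connected (X : topologicalType) : Prop :=
  exists x : X, forall y, path_joined R x y.

Definition all_pi1_trivial (X : topologicalType) : Prop :=
  forall x : X, pi1_trivial R x.

Lemma pi0_eq (X : topologicalType) (x y : X) :
  \pi_(pi0 R X) x = \pi_(pi0 R X) y <-> path_joined R x y.
Proof. by split => [/eqP|xy]; [|apply/eqP]; rewrite eqmodE. Qed.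

Lemma htpy_group_eq (X : topologicalType) n (x : X) (f g : gloop R n x) :
  \pi_(htpy_group R n x) f = \pi_(htpy_group R n x) g <-> loop_homotopic f g.
Proof. by split => [/eqP|xy]; [|apply/eqP]; rewrite eqmodE. Qed.

Lemma pi0_rep (X : topologicalType) (c : pi0 R X) :
  exists x, c = \pi_(pi0 R X) x.
Proof. by exists (repr c); rewrite reprK. Qed.

Lemma htpy_group_rep (X : topologicalType) n (x : X) (c : htpy_group R n x) :
  exists f, c = \pi_(htpy_group R n x) f.
Proof. by exists (repr c); rewrite reprK. Qed.

Lemma eq_loop_homotopic (X : topologicalType) n (x : X) (f g : gloop R n x) :
  f =1 g -> loop_homotopic f g.
Proof.
move=> fg; have /asboolP[H [cH H0 H1 Hb]] := loop_homotopic_refl f.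
by apply/asboolP; exists H; split=> // s; rewrite H1 fg.
Qed.

Section Map.
Variables (X Y : topologicalType) (phi : continuousType X Y).

Lemma pi_map_morph n (x : X) :
  {morph @pi_map R X Y phi n.+1 x : a b / Defs.pi_mul a b}.
Proof.
move=> a b; have [f ->] := htpy_group_rep a; have [g ->] := htpy_group_rep b.
rewrite Defs.pi_mul_pi !pi_map_pi Defs.pi_mul_pi; apply/htpy_group_eq.
by apply: eq_loop_homotopic => s; rewrite /= /concat_fun; case: ifP.
Qed.

(** Induced maps are always multiplicative by [pi_map_morph], so bijectivity remains; it is stated
    on points and loops to keep quotients out of the later proofs. *)
Lemma weak_equivalence_intro :
  (forall y, exists x, path_joined R (phi x) y) ->
  (forall x x', path_joined R (phi x) (phi x') -> path_joined R x x') ->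
  (forall n x (g : gloop R n.+1 (phi x)), exists f : gloop R n.+1 x,
     loop_homotopic (loop_map phi f) g) ->
  (forall n x (f g : gloop R n.+1 x),
     loop_homotopic (loop_map phi f) (loop_map phi g) -> loop_homotopic f g) ->
  weak_homotopy_equivalence R phi.
Proof.
move=> surj0 inj0 surjn injn; split=> [|n x].
  apply: inj_surj_bijective.
    move=> a b; have [x ->] := pi0_rep a; have [x' ->] := pi0_rep b.
    rewrite !pi0_map_pi => /pi0_eq e.
    by apply/pi0_eq; exact: inj0.
  move=> c; have [y ->] := pi0_rep c; have [x xy] := surj0 y; exists (\pi_(pi0 R X) x).
  by rewrite pi0_map_pi; exact/pi0_eq.
split; last exact: pi_map_morph.
apply: inj_surj_bijective.
  move=> a b; have [f ->] := htpy_group_rep a; have [g ->] := htpy_group_rep b.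
  rewrite !pi_map_pi => /htpy_group_eq e.
  by apply/htpy_group_eq; exact: injn.
move=> c; have [g ->] := htpy_group_rep c; have [f fg] := surjn n x g.
exists (\pi_(htpy_group R n.+1 x) f).
by rewrite pi_map_pi; exact/htpy_group_eq.
Qed.

Hypothesis whe : weak_homotopy_equivalence R phi.

Let pi0_surj (y : Y) : exists x, path_joined R (phi x) y.
Proof.
have [[h _ hK] _] := whe; have := hK (\pi_(pi0 R Y) y).
have [x ->] := pi0_rep (h (\pi_(pi0 R Y) y)); rewrite pi0_map_pi => /pi0_eq xy.
by exists x.
Qed.

Let pi0_inj (x x' : X) : path_joined R (phi x) (phi x') -> path_joined R x x'.
Proof.
have [/bij_inj inj _] := whe; move=> /pi0_eq e; apply/pi0_eq; apply: inj.
by rewrite !pi0_map_pi.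
Qed.

Let path_joined_map (x x' : X) : path_joined R x x' -> path_joined R (phi x) (phi x').
Proof. by move=> /pi0_eq e; apply/pi0_eq; rewrite -!pi0_map_pi e. Qed.

Lemma path_connected_whe : path_connected X <-> path_connected Y.
Proof.
split=> [[x xX]|[y yY]].
  exists (phi x) => y; have [x' x'y] := pi0_surj y.
  by apply: path_joined_trans x'y; exact: path_joined_map.
have [x xy] := pi0_surj y; exists x => x'; apply: pi0_inj.
by apply: path_joined_trans xy _; exact: yY.
Qed.

(** From [X] to [Y], the isomorphisms only reach base points in the image of [phi]; any other base
    point is first joined to such a point by a path. *)
Lemma all_pi1_trivial_whe : all_pi1_trivial X <-> all_pi1_trivial Y.
Proof.
split=> [tX y|tY x f g]; last first.
  have [/bij_inj inj _] := whe.2 0%N x.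
  apply/htpy_group_eq; apply: inj; rewrite !pi_map_pi; apply/htpy_group_eq.
  exact: tY.
have [x /pi1_trivial_path] := pi0_surj y; apply => f g.
have [[h _ hK] _] := whe.2 0%N x.
apply/htpy_group_eq; rewrite -[LHS]hK -[RHS]hK; congr (pi_map phi _).
have [f' ->] := htpy_group_rep (h (\pi_(htpy_group R 1 (phi x)) f)).
have [g' ->] := htpy_group_rep (h (\pi_(htpy_group R 1 (phi x)) g)); apply/htpy_group_eq.
exact: tX.
Qed.

End Map.

(** Induction on the generated equivalence; biconditionals pass through its symmetry step. *)
Lemma weakly_equivalent_invariants (X Y : topologicalType) :
  weakly_equivalent R X Y ->
  (path_connected X <-> path_connected Y) /\
  (all_pi1_trivial X <-> all_pi1_trivial Y).
Proof.
elim=> {X Y} [X Y [phi whe]|X|X Y _ [h1 h2]|X Y Z _ [h1 h2] _ [h3 h4]].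
- by split; [exact: path_connected_whe whe|exact: all_pi1_trivial_whe whe].
- by [].
- by split; symmetry.
- by split; [apply: (iff_trans h1)|apply: (iff_trans h2)].
Qed.

End WeakEquivalences.

(** Connectedness of [0, 1], obtained from that of the line by pulling back along [clamp]. *)
Lemma unit_interval_clopen (R : realType) (A : set (set_type (@unitI R))) :
  open A -> open (~` A) -> forall s t, A s -> A t.
Proof.
move=> oA oC s t As.
have /connected_intervalP cR : is_interval [set: R] by [].
have pre (U : set (set_type (@unitI R))) : open U -> open (@clamp R @^-1` U).
  by move=> oU; apply: open_comp => // x _; exact: clamp_continuous.
have e : @clamp R @^-1` A = [set: R].
  apply: cR.
  - by exists (set_val s); rewrite /= clampK.
  - by exists (@clamp R @^-1` A); [exact: pre|rewrite setTI].
  - exists (@clamp R @^-1` A); last by rewrite setTI.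
    by rewrite -[X in closed X]setCK; apply: open_closedC; exact: pre oC.
by have : [set: R] (set_val t) by []; rewrite -e /= clampK.
Qed.

(** * Finite spaces *)

Section Homotopic.
Variable R : realType.
Local Notation I := (set_type (@unitI R)).

Definition homotopic (X Y : topologicalType) (f g : X -> Y) : Prop :=
  exists H : I * X -> Y, [/\ continuous H, forall x, H (zero, x) = f x &
    forall x, H (one, x) = g x].

Lemma homotopic_sym (X Y : topologicalType) (f g : X -> Y) :
  homotopic f g -> homotopic g f.
Proof.
move=> [H [cH H0 H1]]; exists (fun p => H (clamp (1 - set_val p.1), p.2)).
split.
- by apply: (comp_continuous _ cH); continuity.
- by move=> x /=; rewrite val_zero subr0 clamp_ge1.
- by move=> x /=; rewrite val_one subrr clamp_le0.
Qed.

Lemma homotopic_trans (X Y : topologicalType) (f g h : X -> Y) :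
  homotopic f g -> homotopic g h -> homotopic f h.
Proof.
move=> [H [cH H0 H1]] [K [cK K0 K1]]; exists (paste H K); split.
- by apply: paste_continuous => // z; rewrite H1 K0.
- by move=> x; rewrite paste0.
- by move=> x; rewrite paste1.
Qed.

(** The contraction may move the base point, so it only gives a free homotopy of the loop to a
    constant, which [freely_null_loop] makes based. *)
Lemma contractible_pi1_trivial (X : topologicalType) (c : X) :
  homotopic (fun x => x) (fun _ : X => c) -> all_pi1_trivial R X.
Proof.
move=> [H [cH H0 H1]] x; apply/pi1_trivialP => l cl l0 l1.
have := @freely_null_loop _ _ (fun p => H (p.1, l p.2)).
have -> : (fun s => H (zero, l s)) = l by apply/funext => s; rewrite H0.
apply.
- apply: (comp_continuous _ cH); apply: pair_continuous; first by continuity.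
  by apply: (comp_continuous _ cl); continuity.
- by move=> t /=; rewrite l0 l1.
- by move=> s /=; rewrite !H1.
Qed.

End Homotopic.

(** * The specialization preorder and its homotopies *)

Section Specialization.

(** Oriented so that open sets are down-sets, in agreement with [alexandrov]. *)
Definition spec_le (X : topologicalType) (x y : X) : Prop :=
  forall U : set X, open U -> U y -> U x.

(** The homotopy is [f] at time 0 and [g] at all later times. The preimage of an open [U] under [f]
    lies in its preimage under [g], so the jump at 0 keeps preimages open. *)
Lemma spec_le_homotopic (R : realType) (X Y : topologicalType) (f g : X -> Y) :
  continuous f -> continuous g -> (forall x, spec_le (g x) (f x)) ->
  homotopic R f g.
Proof.
move=> cf cg gf.
exists (fun p => if p.1 == zero then f p.2 else g p.2); split => [|x|x].
- apply/continuousP => U oU.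
  have -> : (fun p : set_type (@unitI R) * X =>
      if p.1 == zero then f p.2 else g p.2) @^-1` U =
    (fun p => f p.2) @^-1` U `|`
    ([set p | 0 < set_val p.1] `&` (fun p => g p.2) @^-1` U).
    rewrite eqEsubset; split => -[t x] /=.
      case: eqP => [_|t0 gU]; [by left|right; split=> //].
      rewrite lt_neqAle (andP (val01 t)).1 andbT; apply/eqP => e.
      by apply: t0; apply: set_val_inj; rewrite val_zero.
    case: eqP => [-> [//|[]]|_ [|[]//]].
      by rewrite val_zero ltxx.
    by apply: gf.
  have op (h : X -> Y) : continuous h ->
      open ((fun p : set_type (@unitI R) * X => h p.2) @^-1` U).
    move=> ch; have /continuousP :=
      comp_continuous (@snd_continuous (set_type (@unitI R)) X) ch.
    exact.
  apply: openU; first exact: op.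
  apply: openI; last exact: op.
  apply: (open_comp (f := fun p : set_type (@unitI R) * X => set_val p.1 : R)
    (D := [set r | 0 < r])); last exact: open_gt.
  by move=> p _; move: p; continuity.
- by rewrite eqxx.
- have /negbTE -> // : (one : set_type (@unitI R)) != zero.
  by rewrite eq_sym; exact: clamp01.
Qed.

(** Each of the finitely many points not below [x] is missed by some open neighbourhood of [x];
    these are intersected by induction on a list of points. *)
Lemma finite_spec_nbhs (X : topologicalType) (x : X) :
  finite_set [set: X] -> nbhs x [set w | spec_le w x].
Proof.
move=> /finite_seqP[s sX].
suff h (s' : seq X) : nbhs x [set w | w \in s' -> spec_le w x].
  by apply: filterS (h s) => w /=; apply; have : [set: X] w by []; rewrite sX.
elim: s' => [|a s' IH]; first by apply: filterS filterT.
suff na : nbhs x [set w | w = a -> spec_le w x].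
  apply: filterS (filterI na IH) => w /= [wa ws].
  by rewrite inE => /orP[/eqP|].
have [ax|] := pselect (spec_le a x); first by apply: filterS filterT => w _ ->.
move=> /existsNP[U /not_implyP[oU /not_implyP[Ux Ua]]].
by apply: filterS (open_nbhs_nbhs (conj oU Ux)) => w Uw wa; case: Ua; rewrite -wa.
Qed.

Lemma finite_spec_open (X : topologicalType) (A : set X) :
  finite_set [set: X] -> (forall x y, spec_le x y -> A y -> A x) -> open A.
Proof.
move=> fX dA; rewrite openE => x Ax.
by apply: filterS (finite_spec_nbhs x fX) => w wx; exact: dA wx Ax.
Qed.

Lemma finite_spec_continuous (X Y : topologicalType) (f : X -> Y) :
  finite_set [set: X] ->
  (forall x y, spec_le x y -> spec_le (f x) (f y)) -> continuous f.
Proof.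
move=> fX mf; apply/continuousP => U oU; apply: finite_spec_open => // x y xy.
exact: mf.
Qed.

Lemma crown_spec_le (x y : crown_space) :
  spec_le x y <-> ((x : crown) <= (y : crown))%O.
Proof.
split=> [xy|xy U oU Uy]; last exact: oU xy Uy.
apply: (xy [set z : crown_space | ((z : crown) <= (y : crown))%O]); last exact: lexx.
by move=> a b /= ba ay; exact: le_trans ba ay.
Qed.

End Specialization.

(** * Exhaustive check of the preorders on four labels *)

Section SmallPreorders.

(** In this section [crown] mostly labels four arbitrary points; quantifiers range over explicit
    lists so that they compute. *)
Definition crown_points : seq crown := [:: A1; A2; C1; C2].

Lemma mem_crown_points x : x \in crown_points.
Proof. by case: x. Qed.

Definition tabulate (T : Type) (a b c d : T) (x : crown) : T :=
  match x with A1 => a | A2 => b | C1 => c | C2 => d end.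

Lemma tabulateE (T : Type) (f : crown -> T) :
  tabulate (f A1) (f A2) (f C1) (f C2) = f.
Proof. by apply/funext; case. Qed.

Definition has_self_map (P : (crown -> crown) -> bool) : bool :=
  has (fun a => has (fun b => has (fun c => has (fun d =>
    P (tabulate a b c d)) crown_points) crown_points) crown_points) crown_points.

Lemma has_self_mapP (P : (crown -> crown) -> bool) : has_self_map P -> exists f, P f.
Proof.
by move=> /hasP[a _ /hasP[b _ /hasP[c _ /hasP[d _ h]]]]; exists (tabulate a b c d).
Qed.

Definition all_pred (P : (crown -> bool) -> bool) : bool :=
  let bs := [:: true; false] in
  all (fun a => all (fun b => all (fun c => all (fun d =>
    P (tabulate a b c d)) bs) bs) bs) bs.

Lemma all_predP (P : (crown -> bool) -> bool) : reflect (forall S, P S) (all_pred P).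
Proof.
have bT (b : bool) : b \in [:: true; false] by case: b.
apply: (iffP idP) => [+ S|h]; last by do 4!apply/allP => ? _; exact: h.
move=> /allP/(_ _ (bT (S A1)))/allP/(_ _ (bT (S A2))).
by move=> /allP/(_ _ (bT (S C1)))/allP/(_ _ (bT (S C2))); rewrite tabulateE.
Qed.

Definition all_rel_crown (P : (crown -> crown -> bool) -> bool) : bool :=
  all_pred (fun r1 => all_pred (fun r2 => all_pred (fun r3 => all_pred (fun r4 =>
    P (tabulate r1 r2 r3 r4))))).

Lemma all_rel_crownP (P : (crown -> crown -> bool) -> bool) :
  all_rel_crown P -> forall e, P e.
Proof.
move=> h e; rewrite -(tabulateE e).
by move: h => /all_predP/(_ (e A1))/all_predP/(_ (e A2))/all_predP/(_ (e C1))
  /all_predP/(_ (e C2)).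
Qed.

Definition all_crown (P : crown -> bool) := all P crown_points.

Lemma all_crownP (P : crown -> bool) : reflect (forall x, P x) (all_crown P).
Proof.
apply: (iffP allP) => h x; last by move=> _; exact: h.
by apply: h; exact: mem_crown_points.
Qed.

Definition preorderb (e : crown -> crown -> bool) : bool :=
  all_crown (fun x => e x x) &&
  all_crown (fun x => all_crown (fun y => all_crown (fun z =>
    (e x y && e y z) ==> e x z))).

(** Connectedness of the comparability graph, phrased through two-colourings so that it is decided
    by enumeration. *)
Definition connectedb (e : crown -> crown -> bool) : bool :=
  all_pred (fun S =>
    all_crown (fun x => all_crown (fun y => e x y ==> (S x == S y))) ==>
    all_crown (fun x => S x == S A1)).

(** The two comparisons become homotopies from the identity to [r] and from [r] to a constant. *)
Definition two_step_contractibleb (e : crown -> crown -> bool) : bool :=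
  has_self_map (fun r =>
    all_crown (fun x => all_crown (fun y => e x y ==> e (r x) (r y))) &&
    (all_crown (fun x => e (r x) x) || all_crown (fun x => e x (r x))) &&
    has (fun c => all_crown (fun x => e (r x) c) || all_crown (fun x => e c (r x)))
      crown_points).

Definition crown_leb (x y : crown) : bool := (x == y) || crown_lt x y.

Lemma crown_lebE x y : crown_leb x y = (x <= y)%O.
Proof. by rewrite le_eqVlt. Qed.

Definition crown_isob (e : crown -> crown -> bool) : bool :=
  has_self_map (fun h =>
    all_crown (fun x => all_crown (fun y =>
      ((h x == h y) ==> (x == y)) && (e x y == crown_leb (h x) (h y))))).

(** All 2^16 relations are evaluated. The nested [if] keeps the evaluator from testing the costly
    conclusion outside connected preorders. *)
Lemma connected_preorder_on_four_points :
  all_rel_crown (fun e => if preorderb e then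
    if connectedb e then two_step_contractibleb e || crown_isob e else true
    else true).
Proof. by vm_compute. Qed.

End SmallPreorders.

(** * Spaces with at most four points *)

Section SmallSpaces.
Variables (R : realType) (Z : topologicalType) (f : crown -> Z).
Hypotheses (fZ : finite_set [set: Z]) (fsurj : forall z, exists x, f x = z).
Local Notation I := (set_type (@unitI R)).

Let g (z : Z) : crown := projT1 (cid (fsurj z)).
Let gK z : f (g z) = z. Proof. by rewrite /g; case: cid. Qed.
(** Labels of the same point are equivalent for this preorder, so spaces with fewer than four points
    are covered as well. *)
Let e (x y : crown) : bool := `[< spec_le (f x) (f y) >].

Let eP x y : reflect (spec_le (f x) (f y)) (e x y). Proof. exact: asboolP. Qed.

Let e_spec z w : spec_le z w <-> e (g z) (g w).
Proof. by split=> [zw|/eP]; [apply/eP|]; rewrite !gK. Qed.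

Let e_preorder : preorderb e.
Proof.
apply/andP; split; first by apply/all_crownP => x; apply/eP.
do 3!apply/all_crownP => ?; apply/implyP => /andP[/eP h1 /eP h2]; apply/eP.
by move=> U oU Uz; apply: h1 => //; exact: h2.
Qed.

(** A two-colouring that respects comparability splits [Z] into clopen sets, and a path cannot pass
    from one to the other. *)
Let e_connected : path_connected R Z -> connectedb e.
Proof.
move=> [z0 z0Z]; apply/all_predP => S; apply/implyP => /all_crownP closedS.
have Se x y : e x y -> S x = S y.
  by move=> xy; have /all_crownP/(_ y)/implyP/(_ xy)/eqP := closedS x.
have Sf x : S (g (f x)) = S x by apply: Se; apply/eP; rewrite gK.
have openS b : open [set z | S (g z) = b].
  by apply: finite_spec_open => // x y /e_spec/Se /= ->.
have Sz z : S (g z) = S (g z0).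
  have /asboolP[p] := z0Z z.
  have cp : continuous p := @cts_fun _ _ p.
  pose A := [set t : I | S (g (p t)) = S (g z0)].
  have : A one.
    apply: (@unit_interval_clopen R A _ _ zero); last first.
    - by rewrite /A /= path_zero.
    - rewrite (_ : ~` A = p @^-1` [set z | S (g z) = ~~ S (g z0)]).
        by move/continuousP: cp; apply.
      rewrite eqEsubset; split=> t; rewrite /A /=.
        by case: (S _); case: (S _) => // -[].
      by move=> ->; case: (S _).
    - rewrite (_ : A = p @^-1` [set z | S (g z) = S (g z0)])//.
      by move/continuousP: cp; apply.
  by rewrite /A /= path_one.
by apply/all_crownP => x; apply/eqP; rewrite -(Sf x) -(Sf A1) !Sz.
Qed.

(** The computed alternative is carried over to [Z]: an isomorphism of preorders is a homeomorphism,
    and a two-step contraction is a homotopy from the identity to a constant. *)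
Lemma small_space_dichotomy : path_connected R Z ->
  homeomorphic Z crown_space \/ all_pi1_trivial R Z.
Proof.
move=> /e_connected ec.
have := all_rel_crownP connected_preorder_on_four_points e.
rewrite e_preorder ec => /orP[|]; last first.
  move=> /has_self_mapP[h /all_crownP hP]; left.
  have hinj x y : h x = h y -> x = y.
    move=> hxy; have /all_crownP/(_ y)/andP[/implyP + _] := hP x.
    by rewrite hxy eqxx => /(_ isT)/eqP.
  have he x y : e x y = (h x <= h y)%O.
    by have /all_crownP/(_ y)/andP[_ /eqP] := hP x; rewrite crown_lebE.
  have [h' hK h'K] := injF_bij hinj.
  (* Labels of the same point are comparable both ways, so antisymmetry of the crown order
     identifies them. *)
  have finj x y : f x = f y -> x = y.
    move=> fxy; apply: hinj; apply/le_anti; rewrite -!he.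
    by apply/andP; split; apply/eP; rewrite fxy.
  exists (fun z => h (g z)), (fun c => f (h' c)); split.
  - apply: finite_spec_continuous => // x y /e_spec xy.
    by apply/crown_spec_le; rewrite -he.
  - apply: finite_spec_continuous => [|x y /crown_spec_le xy].
      exact: finite_finset.
    by apply/eP; rewrite he !h'K.
  - by move=> z; rewrite hK gK.
  - by move=> c; rewrite -[RHS]h'K; congr h; apply: finj; rewrite gK.
move=> /has_self_mapP[r /andP[/andP[/all_crownP rmono rid] /hasP[c _ rc]]]; right.
pose r' z := f (r (g z)).
have cr' : continuous r'.
  apply: finite_spec_continuous => // x y /e_spec xy; apply/eP.
  by have /all_crownP/(_ (g y))/implyP := rmono (g x); exact.
apply: (@contractible_pi1_trivial _ _ (f c)).
apply: (@homotopic_trans _ _ _ _ r').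
  case/orP: rid => /all_crownP rid; last apply: homotopic_sym;
    apply: spec_le_homotopic => //; try exact: id_continuous;
    by move=> z; move/eP: (rid (g z)); rewrite gK.
case/orP: rc => /all_crownP rc; first apply: homotopic_sym;
  apply: spec_le_homotopic => //; try exact: const_continuous;
  by move=> z; exact/eP.
Qed.

End SmallSpaces.

(** * The circle is not simply connected *)

Section Circle.
Variable R : realType.
Local Notation I := (set_type (@unitI R)).

Lemma sqr_le1 (x : R) : (x ^+ 2 <= 1) = (-1 <= x <= 1).
Proof.
by rewrite -ler_norml -[RHS](@expr_le1 _ 2)// real_normK// num_real.
Qed.

Definition circle_pt (x y : R) (h : x ^+ 2 + y ^+ 2 = 1) : circle R :=
  SigSub (mem_set (h : [set p : R * R | p.1 ^+ 2 + p.2 ^+ 2 = 1] (x, y))).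

Definition cx (p : circle R) : R := (set_val p).1.
Definition cy (p : circle R) : R := (set_val p).2.

Lemma circleP p : cx p ^+ 2 + cy p ^+ 2 = 1.
Proof. exact: set_valP p. Qed.

Lemma circle_ext p p' : cx p = cx p' -> cy p = cy p' -> p = p'.
Proof.
rewrite /cx /cy !set_valE => hx hy; apply: val_inj.
by rewrite [LHS]surjective_pairing [RHS]surjective_pairing hx hy.
Qed.

Lemma cx_circle_pt x y (h : x ^+ 2 + y ^+ 2 = 1) : cx (circle_pt h) = x.
Proof. by rewrite /cx set_valE. Qed.

Lemma cy_circle_pt x y (h : x ^+ 2 + y ^+ 2 = 1) : cy (circle_pt h) = y.
Proof. by rewrite /cy set_valE. Qed.

Lemma cx_bounds p : -1 <= cx p <= 1.
Proof. by rewrite -sqr_le1 -(circleP p) lerDl sqr_ge0. Qed.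

Lemma cxf_continuous (X : topologicalType) (f : X -> circle R) :
  continuous f -> continuous (fun x => cx (f x)).
Proof.
move=> cf; apply: (@comp_continuous _ _ _ (fun x => set_val (f x)) fst).
  by apply: comp_continuous cf _; exact: initial_continuous.
exact: fst_continuous.
Qed.

Lemma cyf_continuous (X : topologicalType) (f : X -> circle R) :
  continuous f -> continuous (fun x => cy (f x)).
Proof.
move=> cf; apply: (@comp_continuous _ _ _ (fun x => set_val (f x)) snd).
  by apply: comp_continuous cf _; exact: initial_continuous.
exact: snd_continuous.
Qed.

Lemma circle_continuous (X : topologicalType) (f : X -> circle R) :
  continuous (fun x => cx (f x)) -> continuous (fun x => cy (f x)) ->
  continuous f.
Proof.
move=> cfx cfy; apply: continuous_comp_initial.
have -> : set_val \o f = (fun x => (cx (f x), cy (f x))).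
  by apply/funext => x; rewrite /cx /cy /= -surjective_pairing.
exact: pair_continuous.
Qed.

(** Multiplicativity of the complex modulus. *)
Lemma circle_mul_subproof (p q : circle R) :
  (cx p * cx q - cy p * cy q) ^+ 2 + (cx p * cy q + cy p * cx q) ^+ 2 = 1.
Proof.
transitivity ((cx p ^+ 2 + cy p ^+ 2) * (cx q ^+ 2 + cy q ^+ 2)); first by ring.
by rewrite !circleP mulr1.
Qed.

Definition circle_mul p q : circle R := circle_pt (circle_mul_subproof p q).

Lemma circle_conj_subproof (p : circle R) : cx p ^+ 2 + (- cy p) ^+ 2 = 1.
Proof. by rewrite sqrrN circleP. Qed.

Definition circle_conj p : circle R := circle_pt (circle_conj_subproof p).

Lemma circle_one_subproof : 1 ^+ 2 + 0 ^+ 2 = 1 :> R.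
Proof. by ring. Qed.

Definition circle_one : circle R := circle_pt circle_one_subproof.

Lemma cx_mul p q : cx (circle_mul p q) = cx p * cx q - cy p * cy q.
Proof. exact: cx_circle_pt. Qed.

Lemma cy_mul p q : cy (circle_mul p q) = cx p * cy q + cy p * cx q.
Proof. exact: cy_circle_pt. Qed.

Lemma cx_conj p : cx (circle_conj p) = cx p.
Proof. exact: cx_circle_pt. Qed.

Lemma cy_conj p : cy (circle_conj p) = - cy p.
Proof. exact: cy_circle_pt. Qed.

Lemma cx_one : cx circle_one = 1.
Proof. exact: cx_circle_pt. Qed.

Lemma cy_one : cy circle_one = 0.
Proof. exact: cy_circle_pt. Qed.

Definition circle_coordE := (cx_mul, cy_mul, cx_conj, cy_conj, cx_one, cy_one).

Lemma circle_mulf_continuous (X : topologicalType) (f g : X -> circle R) :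
  continuous f -> continuous g -> continuous (fun x => circle_mul (f x) (g x)).
Proof.
move=> cf cg.
have cfx := cxf_continuous cf; have cfy := cyf_continuous cf.
have cgx := cxf_continuous cg; have cgy := cyf_continuous cg.
apply: circle_continuous.
  rewrite (_ : (fun x => _) =
    (fun x => cx (f x) * cx (g x) + - (cy (f x) * cy (g x)))); first by continuity.
  by apply/funext => x; rewrite circle_coordE.
rewrite (_ : (fun x => _) =
    (fun x => cx (f x) * cy (g x) + cy (f x) * cx (g x))); first by continuity.
by apply/funext => x; rewrite circle_coordE.
Qed.

Lemma circle_conjf_continuous (X : topologicalType) (f : X -> circle R) :
  continuous f -> continuous (fun x => circle_conj (f x)).
Proof.
move=> cf; have cfx := cxf_continuous cf; have cfy := cyf_continuous cf.
apply: circle_continuous.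
  rewrite (_ : (fun x => _) = (fun x => cx (f x))); first by [].
  by apply/funext => u; rewrite circle_coordE.
rewrite (_ : (fun x => _) = (fun u => - cy (f u))); first by continuity.
by apply/funext => u; rewrite circle_coordE.
Qed.

Lemma half_circle_subproof (t : I) :
  (1 - 2 * set_val t) ^+ 2 + Num.sqrt (1 - (1 - 2 * set_val t) ^+ 2) ^+ 2 = 1.
Proof.
have t01 := val01 t.
rewrite sqr_sqrtr ?subrKC//.
by rewrite subr_ge0 sqr_le1; apply/andP; split; lra.
Qed.

(** The upper half circle from 1 to -1, parametrized by its abscissa so that a square root replaces
    trigonometry. *)
Definition half_circle (t : I) : circle R := circle_pt (half_circle_subproof t).

Lemma cx_half_circle t : cx (half_circle t) = 1 - 2 * set_val t.
Proof. exact: cx_circle_pt. Qed.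

Lemma cy_half_circle t :
  cy (half_circle t) = Num.sqrt (1 - (1 - 2 * set_val t) ^+ 2).
Proof. exact: cy_circle_pt. Qed.

Definition half_circleE := (cx_half_circle, cy_half_circle).

Lemma half_circle_continuous : continuous half_circle.
Proof.
apply: circle_continuous.
  rewrite (_ : (fun x => _) = (fun t : I => 1 + - (2 * set_val t))).
    by continuity.
  by apply/funext => x; rewrite (half_circleE, circle_coordE).
rewrite (_ : (fun x => _) = (fun t : I =>
  Num.sqrt (1 + - ((1 + - (2 * set_val t)) * (1 + - (2 * set_val t)))))).
  by continuity.
by apply/funext => x; rewrite (half_circleE, circle_coordE).
Qed.

Lemma half_circle0 : half_circle zero = circle_one.
Proof.
by apply: circle_ext; rewrite !(half_circleE, circle_coordE) val_zero mulr0 subr0// expr1n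
  subrr sqrtr0.
Qed.

Lemma cx_half_circle1 : cx (half_circle one) = - 1.
Proof. by rewrite (half_circleE, circle_coordE) val_one; lra. Qed.

Lemma cy_half_circle1 : cy (half_circle one) = 0.
Proof.
by rewrite (half_circleE, circle_coordE) val_one (_ : 1 - _ ^+ 2 = 0) ?sqrtr0//; ring.
Qed.

(** The path is an initial piece of the upper half circle, stopped at the abscissa of [p] and
    conjugated when [p] lies below the axis. *)
Lemma path_joined_circle_one p : path_joined R circle_one p.
Proof.
pose t : I := clamp ((1 - cx p) / 2).
have pb := cx_bounds p.
have tE : set_val t = (1 - cx p) / 2 by rewrite val_clamp//; lra.
have xE : 1 - 2 * set_val t = cx p by rewrite tE; lra.
have yE : Num.sqrt (1 - (1 - 2 * set_val t) ^+ 2) = `|cy p|.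
  by rewrite xE -(circleP p) addrAC subrr add0r sqrtr_sqr.
pose h (u : I) := half_circle (clamp (set_val u * set_val t)).
have ch : continuous h.
  by apply: (comp_continuous _ half_circle_continuous); continuity.
have h0 : h zero = circle_one by rewrite /h val_zero mul0r clamp_le0// half_circle0.
have h1 : h one = half_circle t by rewrite /h val_one mul1r clampK.
apply/asboolP.
have [y0|y0] := leP 0 (cy p).
  apply: (@inhabited_path _ _ _ _ h ch h0); rewrite h1.
  by apply: circle_ext; rewrite !(half_circleE, circle_coordE) ?xE// -xE yE ger0_norm.
apply: (@inhabited_path _ _ _ _ (fun u => circle_conj (h u))).
- exact: circle_conjf_continuous.
- by rewrite h0; apply: circle_ext; rewrite !(half_circleE, circle_coordE) ?oppr0.
- rewrite h1; apply: circle_ext; rewrite !(half_circleE, circle_coordE) ?xE//.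
  by rewrite -xE yE ltr0_norm ?opprK.
Qed.

Lemma path_joined_circle (p p' : circle R) : path_joined R p p'.
Proof.
apply: path_joined_trans (path_joined_circle_one p').
by rewrite path_joined_sym path_joined_circle_one.
Qed.

Lemma path_connected_circle : path_connected R (circle R).
Proof. by exists circle_one; exact: path_joined_circle_one. Qed.

(* A loop has a square root that is again a loop exactly when its winding
   number is even. *)
Definition even_loop (f : I -> circle R) : Prop :=
  exists g : I -> circle R, [/\ continuous g, g zero = g one &
    forall s, f s = circle_mul (g s) (g s)].

(** For z = a + ib this is (1 + z) / |1 + z|, the principal square root of z, with |1 + z|^2 = 2 (1
    + a). *)
Lemma circle_root_subproof (a b : R) : a ^+ 2 + b ^+ 2 = 1 -> 0 < a ->
  ((1 + a) / Num.sqrt (2 * (1 + a))) ^+ 2 + (b / Num.sqrt (2 * (1 + a))) ^+ 2 = 1.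
Proof.
move=> ab a0; rewrite !expr_div_n sqr_sqrtr; last by lra.
have n0 : 2 * (1 + a) != 0 by apply: lt0r_neq0; lra.
rewrite -mulrDl (_ : (1 + a) ^+ 2 + b ^+ 2 = 2 * (1 + a)) ?divff//.
transitivity (1 + 2 * a + (a ^+ 2 + b ^+ 2)); first by ring.
by rewrite ab; ring.
Qed.

Definition circle_root p (p0 : 0 < cx p) : circle R :=
  circle_pt (circle_root_subproof (circleP p) p0).

Lemma circle_rootK p (p0 : 0 < cx p) :
  circle_mul (circle_root p0) (circle_root p0) = p.
Proof.
have n0 : 2 * (1 + cx p) != 0 by apply: lt0r_neq0; lra.
have n1 : Num.sqrt (2 * (1 + cx p)) ^+ 2 = 2 * (1 + cx p).
  by rewrite sqr_sqrtr//; lra.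
have y2 : cy p ^+ 2 = 1 - cx p ^+ 2 by rewrite -(circleP p); ring.
apply: circle_ext; rewrite circle_coordE cx_circle_pt cy_circle_pt.
  transitivity (((1 + cx p) ^+ 2 - cy p ^+ 2) / Num.sqrt (2 * (1 + cx p)) ^+ 2).
    by rewrite -exprVn; ring.
  apply: (mulIf n0); rewrite n1 y2 divfK//; ring.
transitivity ((2 * (1 + cx p)) * cy p / Num.sqrt (2 * (1 + cx p)) ^+ 2).
  by rewrite -exprVn; ring.
by rewrite n1 mulrAC divff// mul1r.
Qed.

(** The quotient of [f'] by [f] has positive real part, so its principal square root is a continuous
    loop; multiplied by a root of [f] it gives a root of [f']. *)
Lemma even_loop_close (f f' : I -> circle R) :
  continuous f -> continuous f' -> f zero = f one -> f' zero = f' one ->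
  (forall s, 0 < cx (f s) * cx (f' s) + cy (f s) * cy (f' s)) ->
  even_loop f -> even_loop f'.
Proof.
move=> cf cf' f01 f01' ff' [g [cg g01 gE]].
pose w s := circle_mul (f' s) (circle_conj (f s)).
have wx s : cx (w s) = cx (f s) * cx (f' s) + cy (f s) * cy (f' s).
  by rewrite /w !circle_coordE; ring.
have w0 s : 0 < cx (w s) by rewrite wx.
pose h s := circle_root (w0 s).
have hx s : cx (h s) = (1 + cx (w s)) / Num.sqrt (2 * (1 + cx (w s))).
  exact: cx_circle_pt.
have hy s : cy (h s) = cy (w s) / Num.sqrt (2 * (1 + cx (w s))).
  exact: cy_circle_pt.
have hh s : circle_mul (h s) (h s) = w s by exact: circle_rootK.
have cw : continuous w.
  by apply: circle_mulf_continuous => //; exact: circle_conjf_continuous.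
have ch : continuous h.
  have cx_w := cxf_continuous cw; have cy_w := cyf_continuous cw.
  have ci : continuous (fun s => (Num.sqrt (2 * (1 + cx (w s))))^-1).
    apply: invf_continuous => [|s]; first by continuity.
    by rewrite sqrtr_eq0 -ltNge; have := w0 s; lra.
  apply: circle_continuous.
    rewrite (_ : (fun x => _) =
      (fun s => (1 + cx (w s)) * (Num.sqrt (2 * (1 + cx (w s))))^-1)).
      by continuity.
    by apply/funext => u; rewrite hx.
  rewrite (_ : (fun x => _) =
    (fun s => cy (w s) * (Num.sqrt (2 * (1 + cx (w s))))^-1)).
    by continuity.
  by apply/funext => u; rewrite hy.
have w01 : w zero = w one by rewrite /w f01 f01'.
exists (fun s => circle_mul (g s) (h s)); split.
- exact: circle_mulf_continuous.
- rewrite g01; congr circle_mul.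
  by apply: circle_ext; rewrite ?hx ?hy w01.
- move=> s.
  have -> : circle_mul (circle_mul (g s) (h s)) (circle_mul (g s) (h s)) =
    circle_mul (f s) (w s).
    by rewrite gE -hh; apply: circle_ext;
      move: (g s) (h s) => a b; rewrite !circle_coordE; ring.
  rewrite /w; move: (f s) (f' s) => a b.
  apply: circle_ext; rewrite !circle_coordE.
    transitivity ((cx a ^+ 2 + cy a ^+ 2) * cx b); last by ring.
    by rewrite circleP mul1r.
  transitivity ((cx a ^+ 2 + cy a ^+ 2) * cy b); last by ring.
  by rewrite circleP mul1r.
Qed.

Lemma unit_interval_compact : compact [set: I].
Proof.
have -> : [set: I] = @clamp R @` `[0, 1].
  rewrite eqEsubset; split=> // t _; exists (set_val t); last exact: clampK.
  by rewrite /= in_itv /= val01.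
apply: continuous_compact; last exact: segment_compact.
by apply: continuous_subspaceT; exact: clamp_continuous.
Qed.

Lemma circle_pi1_nontrivial : ~ all_pi1_trivial R (circle R).
Proof.
move=> /(_ circle_one)/pi1_trivialP tr.
(* The loop of degree one, as the square of a path from 1 to -1. *)
pose e s := circle_mul (half_circle s) (half_circle s).
have e0 : e zero = circle_one.
  by rewrite /e half_circle0; apply: circle_ext; rewrite !circle_coordE; ring.
have e1 : e one = circle_one.
  by apply: circle_ext; rewrite !circle_coordE cx_half_circle1 cy_half_circle1; ring.
have ce : continuous e.
  by apply: circle_mulf_continuous; exact: half_circle_continuous.
have [K [cK K0 K1 Kz Ko]] := tr e ce e0 e1.
rewrite e0 in K1 Kz Ko.
pose D (t t' s : I) := cx (K (t, s)) * cx (K (t', s)) + cy (K (t, s)) * cy (K (t', s)).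
(* Compactness in [s] turns pointwise closeness into a neighbourhood of [t] valid for the whole
   loop. *)
have close t : \forall t' \near t, forall s, 0 < D t t' s.
  suff : \forall t' \near nbhs t, [set: I] `<=` (fun s => 0 < D t t' s).
    by apply: filterS => t' h s; exact: h.
  have /compact_near_coveringP := unit_interval_compact.
  apply => s _.
  have cD : continuous (fun p : I * I => D t p.2 p.1).
    have c1 : continuous (fun p : I * I => K (t, p.1)).
      by apply: (comp_continuous _ cK); continuity.
    have c2 : continuous (fun p : I * I => K (p.2, p.1)).
      by apply: (comp_continuous _ cK); continuity.
    have := (cxf_continuous c1, cyf_continuous c1, cxf_continuous c2,
      cyf_continuous c2).
    by move=> [[[? ?] ?] ?]; rewrite /D; continuity.
  have Dpos : 0 < D t t s by rewrite /D -!expr2 circleP.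
  have near_pos : nbhs (s, t) [set p : I * I | 0 < D t p.2 p.1].
    exact: (cvgr_gt (D t t s) (cD (s, t)) 0 Dpos).
  exact: near_pos.
pose ev t := even_loop (fun s => K (t, s)).
have cKt t : continuous (fun s => K (t, s)).
  by apply: (comp_continuous _ cK); continuity.
(* Both directions are needed: they make [ev] and its complement open. *)
have evl t : \forall t' \near t, ev t <-> ev t'.
  apply: filterS (close t) => t' tt'; split.
    by apply: even_loop_close => //; rewrite ?Kz ?Ko.
  apply: even_loop_close => //; rewrite ?Kz ?Ko// => s.
  by have := tt' s; rewrite /D [cx _ * cx _]mulrC [cy _ * cy _]mulrC.
have ev1 : ev one.
  exists (fun=> circle_one); split => //; first exact: const_continuous.
  by move=> s; rewrite K1; apply: circle_ext; rewrite !circle_coordE; ring.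
have [g [cg g01 gE]] : ev zero.
  apply: (@unit_interval_clopen R [set t | ev t] _ _ one) => //.
    rewrite openE => t evt; rewrite /interior.
    by apply: filterS (evl t) => t' [+ _]; apply.
  rewrite openE => t evt; rewrite /interior.
  by apply: filterS (evl t) => t' [_ h] /h.
(* [g] and [half_circle] are square roots of the same loop, so their inner product is 1 or -1. By
   continuity its sign is constant, yet it flips between the ends, as [g] closes up and
   [half_circle] runs from 1 to -1. *)
pose u s := cx (g s) * cx (half_circle s) + cy (g s) * cy (half_circle s).
have cu : continuous u.
  have := (cxf_continuous cg, cyf_continuous cg,
    cxf_continuous half_circle_continuous, cyf_continuous half_circle_continuous).
  by move=> [[[? ?] ?] ?]; rewrite /u; continuity.
have u2 s : u s ^+ 2 = 1.
  have := gE s; rewrite K0 /e /u; move: (g s) (half_circle s) => a b ab.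
  have hx : cx b * cx b - cy b * cy b = cx a * cx a - cy a * cy a.
    by move: (congr1 cx ab); rewrite !circle_coordE.
  have hy : cx b * cy b + cy b * cx b = cx a * cy a + cy a * cx a.
    by move: (congr1 cy ab); rewrite !circle_coordE.
  have ha := circleP a; have hb := circleP b.
  rewrite -!expr2 in hx.
  have x2 : cx a ^+ 2 = cx b ^+ 2 by lra.
  have y2 : cy a ^+ 2 = cy b ^+ 2 by lra.
  have xy : cx a * cy a = cx b * cy b by lra.
  transitivity (cx a ^+ 2 * cx b ^+ 2 + 2 * (cx a * cy a) * (cx b * cy b) +
    cy a ^+ 2 * cy b ^+ 2); first by ring.
  rewrite x2 y2 xy; transitivity ((cx b ^+ 2 + cy b ^+ 2) ^+ 2); first by ring.
  by rewrite hb expr1n.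
have u1 : u one = - u zero.
  rewrite /u cx_half_circle1 cy_half_circle1 half_circle0 g01.
  by rewrite !circle_coordE; ring.
have u0 s : u s * u zero != 0.
  rewrite -sqrf_eq0 exprMn !u2 mulr1; exact: oner_neq0.
have cuu : continuous (fun s => u s * u zero) by continuity.
have : [set s | 0 < u s * u zero] one.
  apply: (@unit_interval_clopen R [set s | 0 < u s * u zero] _ _ zero).
  - apply: (open_comp (f := fun s => u s * u zero) (D := [set r | 0 < r])).
      by move=> s _; exact: cuu.
    exact: open_gt.
  - have -> : ~` [set s | 0 < u s * u zero] = [set s | u s * u zero < 0].
      rewrite eqEsubset; split=> s /=.
        by move/negP; rewrite -leNgt le_eqVlt (negbTE (u0 s)).
      by move=> us; apply/negP; rewrite -leNgt ltW.
    apply: (open_comp (f := fun s => u s * u zero) (D := [set r | r < 0])).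
      by move=> s _; exact: cuu.
    exact: open_lt.
  - by rewrite /= -expr2 u2.
by rewrite /= u1 mulNr -expr2 u2; lra.
Qed.

End Circle.

(** * The circle and the crown *)

Section ZeroSets.
Variables (R : realType) (X : topologicalType) (d : X -> X -> R).
Hypothesis d_continuous : forall y, continuous (d ^~ y).
Hypothesis d_sym : forall x y, d x y = d y x.
Hypothesis d_triangle : forall x y z, d x z <= d x y + d y z.
Hypothesis d_ge0 : forall x y, 0 <= d x y.
Hypothesis d_refl : forall x, d x x = 0.
Hypothesis d_eq0 : forall x y, d x y = 0 -> x = y.

Let dist (F : set X) x : R := inf [set d x y | y in F].

(** The function is the distance to [F]. The metric is only known to be continuous, not to generate
    the topology, so compactness shows that the distance is positive off [F]. *)
Lemma closed_zero_set (F : set X) : compact [set: X] -> closed F ->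
  exists f : X -> R, [/\ continuous f, forall x, 0 <= f x &
    forall x, f x = 0 <-> F x].
Proof.
(* The infimum of the empty set is 0 by convention, the wrong value here. *)
move=> cX cF; have [->|/set0P[a Fa]] := eqVneq F set0.
  exists (fun=> 1); split => [|x|x]; first exact: const_continuous.
    exact: ler01.
  by split=> [/eqP|//]; rewrite oner_eq0.
have has_lb x : has_lbound [set d x y | y in F] by exists 0 => _ [y _ <-].
have dist_le x y : F y -> dist F x <= d x y.
  by move=> Fy; apply: ge_inf => //; exists y.
have dist_ge x c : (forall y, F y -> c <= d x y) -> c <= dist F x.
  move=> h; apply: lb_le_inf; first by exists (d x a), a.
  by move=> _ [y Fy <-]; exact: h.
have lip x x' : dist F x <= d x x' + dist F x'.
  rewrite -lerBlDl; apply: dist_ge => y Fy; rewrite lerBlDl.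
  exact: le_trans (dist_le _ _ Fy) (d_triangle _ _ _).
exists (dist F); split => [x|x|x].
- apply/cvgrPdist_lt => eps eps0.
  have : \forall y \near x, d y x < eps.
    have dx : d x x < eps by rewrite d_refl.
    exact: (cvgr_lt (d x x) (@d_continuous x x) eps dx).
  apply: filterS => y yx; rewrite (le_lt_trans _ yx)// ler_norml.
  have h1 := lip x y; have h2 := lip y x; rewrite d_sym in h1.
  by apply/andP; split; lra.
- by apply: dist_ge.
- split=> [f0|Fx]; last first.
    by apply/le_anti; rewrite -{1}(d_refl x) dist_le//= dist_ge.
  apply: contrapT => nFx.
  have cptF : compact F by apply: (subclosed_compact cF cX).
  (* Near each [y] in [F] the distance to [x] stays above half of [d x y]; compactness gives one
     positive bound for all of [F]. *)
  have /compact_near_coveringP/(_ _ (0 : R)^'+ (fun e y => e < d x y)) := cptF.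
  have cover y : F y -> \forall y' \near y & e \near (0 : R)^'+, e < d x y'.
    move=> Fy; have dxy : 0 < d x y.
      rewrite lt_neqAle d_ge0 eq_sym andbT; apply/eqP => /d_eq0 xy.
      by apply: nFx; rewrite xy.
    exists ([set y' | d x y / 2 < d x y'], [set e | e < d x y / 2]) => /=; last first.
      by move=> [y' e] /= [h1 h2]; exact: lt_trans h1.
    split; last by apply: nbhs_right_lt; lra.
    have c : continuous (fun y' => d x y').
      by rewrite (_ : (fun y' => _) = d ^~ x)//; apply/funext => y'; exact: d_sym.
    by apply: (cvgr_gt (d x y) (c y)); lra.
  move=> /(_ _ cover) h.
  have [e [e0 he]] : exists e : R, 0 < e /\ F `<=` (fun y => e < d x y).
    have /filter_ex[e [he e0]] :
        (0 : R)^'+ ((fun e => F `<=` (fun y => e < d x y)) `&` [set e | 0 < e]).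
      by apply: filterI => //; exact: nbhs_right_gt.
    by exists e.
  have : e <= dist F x by apply: dist_ge => y /he; exact: ltW.
  by rewrite f0; lra.
Qed.

End ZeroSets.

Section CubeZeroSets.
Variables (R : realType) (n : nat).
Local Notation I := (set_type (@unitI R)).
Local Notation X := (I * cube R n)%type.

Lemma cube_compact : compact [set: X].
Proof.
rewrite -setXTT; apply: compact_setX; first exact: unit_interval_compact.
have := @tychonoff 'I_n (fun=> I) (fun=> setT) (fun=> @unit_interval_compact R).
by congr compact; rewrite eqEsubset.
Qed.

Let d (p q : X) : R := `|set_val p.1 - set_val q.1| +
  \sum_(i < n) `|set_val (p.2 i) - set_val (q.2 i)|.

Lemma cube_closed_zero_set (F : set X) : closed F ->
  exists f : X -> R, [/\ continuous f, forall x, 0 <= f x &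
    forall x, f x = 0 <-> F x].
Proof.
apply: (@closed_zero_set R X d); last exact: cube_compact.
- move=> y; rewrite /d; apply: addf_continuous; first by continuity.
  apply: continuous_big; first by continuity.
  move=> i _; apply: normf_continuous; apply: addf_continuous; last by continuity.
  by apply: set_valf_continuous; apply: coordf_continuous; continuity.
- move=> x y; rewrite /d distrC; congr (_ + _).
  by apply: eq_bigr => i _; rewrite distrC.
- move=> x y z; rewrite /d addrACA lerD ?ler_distD// -big_split /=.
  by apply: ler_sum => i _; rewrite ler_distD.
- by move=> x y; rewrite /d addr_ge0// sumr_ge0.
- move=> x; rewrite /d subrr normr0 add0r big1// => i _.
  by rewrite subrr normr0.
- move=> [t s] [t' s']; rewrite /d /= => /eqP.
  rewrite paddr_eq0// ?sumr_ge0// normr_eq0 subr_eq0 => /andP[/eqP tt'].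
  rewrite psumr_eq0// => /allP ss'; congr pair; first exact: set_val_inj.
  apply/funext => i; apply: set_val_inj; apply/eqP.
  by rewrite -subr_eq0 -normr_eq0; apply: ss'; rewrite mem_index_enum.
Qed.

End CubeZeroSets.

(** * The quotient map from the circle to the crown and its lifts *)

Section CircleToCrown.
Variable R : realType.
Local Notation I := (set_type (@unitI R)).
Local Notation S1 := (circle R).

Definition circle_to_crown (p : S1) : crown_space :=
  if 0 < cy p then C1 else if cy p < 0 then C2 else if 0 < cx p then A1 else A2.

Local Notation q := circle_to_crown.

Variant circle_to_crown_spec (p : S1) : crown -> Prop :=
| QA1 of cx p = 1 & cy p = 0 : circle_to_crown_spec p A1
| QA2 of cx p = -1 & cy p = 0 : circle_to_crown_spec p A2
| QC1 of -1 < cx p < 1 & 0 < cy p : circle_to_crown_spec p C1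
| QC2 of -1 < cx p < 1 & cy p < 0 : circle_to_crown_spec p C2.

Lemma circle_to_crownP p : circle_to_crown_spec p (q p).
Proof.
have hp := circleP p; rewrite /q.
have in1 : cy p != 0 -> -1 < cx p < 1.
  move=> y0; have : 0 < cy p ^+ 2 by rewrite lt_neqAle sqr_ge0 eq_sym sqrf_eq0 y0.
  move=> y2; have /andP[h1 h2] := cx_bounds p; rewrite !lt_neqAle h1 h2 !andbT.
  apply/andP; split; apply/eqP => e; move: hp y2; first rewrite -e; last rewrite e.
    by rewrite sqrrN expr1n; lra.
  by rewrite expr1n; lra.
case: ltP => [y0|y0]; first by constructor=> //; apply: in1; rewrite gt_eqF.
case: ltP => [y1|y1]; first by constructor=> //; apply: in1; rewrite lt_eqF.
have y : cy p = 0 by lra.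
have : (cx p - 1) * (cx p + 1) = 0.
  by transitivity (cx p ^+ 2 + cy p ^+ 2 - 1); [rewrite y; ring|rewrite hp subrr].
by move=> /eqP; rewrite mulf_eq0 => /orP[] /eqP h; case: ltP => h';
  constructor => //; lra.
Qed.

(** On the arcs the map is locally constant. Near one of the two remaining points, an open half
    plane excludes the other one, and all values left lie below the given value, hence in any open
    set containing it. *)
Lemma circle_to_crown_continuous : continuous q.
Proof.
apply/continuousP => U oU; rewrite openE => p Up; rewrite /interior.
have nb (f : S1 -> R) c : continuous f -> c < f p -> nbhs p [set p' | c < f p'].
  by move=> cf fp; exact: (cvgr_gt (f p) (cf p)).
have cxc : continuous (@cx R) by apply: cxf_continuous; exact: id_continuous.
have cyc : continuous (@cy R) by apply: cyf_continuous; exact: id_continuous.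
have cyn : continuous (fun p : S1 => - cy p) by exact: oppf_continuous cyc.
have cxn : continuous (fun p : S1 => - cx p) by exact: oppf_continuous cxc.
move: Up; rewrite /preimage /=; case: circle_to_crownP => h1 h2 Up.
- apply: filterS (nb (@cx R) 0 cxc _); last by rewrite h1.
  move=> p' /= p'0; case: circle_to_crownP => // [||]; try by (move=> ? ?; apply: oU Up).
  by move=> h3; exfalso; lra.
- apply: filterS (nb _ 0 cxn _); last by rewrite h1; lra.
  move=> p' /= p'0; case: circle_to_crownP => // [||]; try by (move=> ? ?; apply: oU Up).
  by move=> h3; exfalso; lra.
- apply: filterS (nb (@cy R) 0 cyc h2) => p' /= p'0.
  by case: circle_to_crownP => // h3 h4; exfalso; lra.
- apply: filterS (nb _ 0 cyn _); last by lra.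
  move=> p' /= p'0.
  by case: circle_to_crownP => // h3 h4; exfalso; lra.
Qed.

(** The abscissa determines the ordinate up to sign and the value in the crown decides the sign, so
    a lift is determined by its first coordinate. *)
Lemma circle_to_crown_inj p p' : q p = q p' -> cx p = cx p' -> p = p'.
Proof.
move=> qq xx; apply: circle_ext => //; have := circleP p; have := circleP p'.
rewrite xx; move=> <- /addrI/eqP; rewrite eqf_sqr => /orP[/eqP//|/eqP h].
move: qq; case: circle_to_crownP; case: circle_to_crownP => //; lra.
Qed.

Lemma crown_open (U : set crown_space) :
  (forall x y : crown, (y <= x)%O -> U x -> U y) -> open U.
Proof. by move=> h; exact: h. Qed.

Lemma closed_down_compl (X : topologicalType) (g : X -> crown_space) (c : crown) :
  continuous g -> (forall y : crown, (y <= c)%O -> y = c) ->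
  closed [set x | g x <> c].
Proof.
move=> /continuousP cg minc; rewrite (_ : mkset _ = ~` (g @^-1` [set c])).
  apply: open_closedC; apply: cg; apply: crown_open => x y /= yx xc.
  by apply: minc; rewrite -xc.
by [].
Qed.

(* [u] is the first coordinate of a lift of [g] through [circle_to_crown]. *)
Definition over_crown (X : topologicalType) (g : X -> crown_space) (u : X -> R) :=
  [/\ continuous u, forall x, -1 <= u x <= 1, forall x, u x = 1 <-> g x = A1 &
     forall x, u x = -1 <-> g x = A2].

(** The second coordinate is a square root with sign dictated by [g]. It is glued along the closed
    sets where [g] avoids [C2] and where it avoids [C1]; on their overlap [u] is 1 or -1 and the
    root vanishes. *)
Lemma over_crown_lift (X : topologicalType) (g : X -> crown_space) (u : X -> R) :
  continuous g -> over_crown g u -> exists h : X -> S1,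
    [/\ continuous h, forall x, q (h x) = g x & forall x, cx (h x) = u x].
Proof.
move=> cg [cu u1 uA1 uA2].
pose y x := (if g x == C2 then -1 else 1) * Num.sqrt (1 - u x ^+ 2).
have yP x : u x ^+ 2 + y x ^+ 2 = 1.
  rewrite /y exprMn sqr_sqrtr ?subr_ge0 ?sqr_le1//.
  by case: ifP => _; ring.
pose h x := circle_pt (yP x).
have hx x : cx (h x) = u x by exact: cx_circle_pt.
have hy x : cy (h x) = y x by exact: cy_circle_pt.
exists h; split => //.
- apply: circle_continuous.
    by rewrite (_ : (fun x => _) = u)//; apply/funext.
  rewrite (_ : (fun x => _) = y); last exact/funext.
  have cs : continuous (fun x => Num.sqrt (1 + - (u x * u x))) by continuity.
  have csn : continuous (fun x => - Num.sqrt (1 + - (u x * u x))) by continuity.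
  have min1 (c : crown) : (c <= C1)%O -> c = C1 by case: c.
  have min2 (c : crown) : (c <= C2)%O -> c = C2 by case: c.
  apply: (closed_cover_continuous (closed_down_compl cg min2)
    (closed_down_compl cg min1) _ cs csn).
  + by move=> x /=; case: (g x); [left|left|left|right].
  + by move=> x /= /eqP/negbTE gx; rewrite /y gx mul1r expr2.
  + move=> x /= gx; rewrite /y; case: ifP => [_|/eqP gx']; first by rewrite mulN1r expr2.
    rewrite mul1r -expr2; case gxE : (g x) gx gx' => // _ _.
    * by move/uA1: gxE => ->; rewrite expr1n subrr sqrtr0 oppr0.
    * by move/uA2: gxE => ->; rewrite sqrrN expr1n subrr sqrtr0 oppr0.
- move=> x; have u1x := u1 x.
  have s0 : g x <> A1 -> g x <> A2 -> 0 < Num.sqrt (1 - u x ^+ 2).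
    move=> /uA1 n1 /uA2 n2; rewrite sqrtr_gt0 subr_gt0 lt_neqAle sqr_le1 u1x andbT.
    rewrite sqrf_eq1; apply/negP => /orP[] /eqP; [exact: n1|exact: n2].
  case: circle_to_crownP; rewrite hx hy.
  + by move=> /uA1 ->.
  + by move=> /uA2 ->.
  + move=> ux; rewrite /y; case gxE : (g x) => //= h0; exfalso.
    * by move/uA1: gxE; lra.
    * by move/uA2: gxE; lra.
    * by move: h0; rewrite mulN1r; have := sqrtr_ge0 (1 - u x ^+ 2); lra.
  + move=> ux; rewrite /y; case gxE : (g x) => //= h0; exfalso; move: h0;
    by rewrite mul1r; have := sqrtr_ge0 (1 - u x ^+ 2); lra.
Qed.

Lemma convex_lt (t a b c : R) : 0 <= t <= 1 -> a < c -> b < c ->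
  (1 + - t) * a + t * b < c.
Proof.
move=> /andP[t0 t1] ac bc; have [->|tn0] := eqVneq t 0; first by lra.
have tb : t * b < t * c by rewrite ltr_pM2l// lt_neqAle eq_sym tn0.
have ta : (1 + - t) * a <= (1 + - t) * c by apply: ler_wpM2l; [lra|exact: ltW].
by lra.
Qed.

Lemma convex_gt (t a b c : R) : 0 <= t <= 1 -> c < a -> c < b ->
  c < (1 + - t) * a + t * b.
Proof.
move=> t01 ca cb; have := @convex_lt t (- a) (- b) (- c) t01.
by rewrite !ltrN2 => /(_ ca cb); lra.
Qed.

(** Abscissae are interpolated linearly: over each point both are 1, both -1, or both strictly
    between, and convex combinations preserve this. [circle_to_crown_inj] then identifies the ends
    and the stationary points. *)
Lemma fibrewise_homotopy (X : topologicalType) (f h : X -> S1) :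
  continuous f -> continuous h -> (forall x, q (f x) = q (h x)) ->
  exists H : I * X -> S1, [/\ continuous H, forall x, H (zero, x) = f x,
    forall x, H (one, x) = h x & forall t x, f x = h x -> H (t, x) = f x].
Proof.
move=> cf ch fh.
pose u (p : I * X) := (1 + - set_val p.1) * cx (f p.2) + set_val p.1 * cx (h p.2).
have cfs : continuous (fun p : I * X => f p.2).
  by apply: (comp_continuous _ cf); continuity.
have chs : continuous (fun p : I * X => h p.2).
  by apply: (comp_continuous _ ch); continuity.
have cG : continuous (fun p : I * X => q (f p.2)).
  exact: comp_continuous cfs circle_to_crown_continuous.
have ov : over_crown (fun p : I * X => q (f p.2)) u.
  have cxfs := cxf_continuous cfs; have cxhs := cxf_continuous chs.
  split; first by rewrite /u; continuity.
  - move=> [t x]; rewrite /u /=; have t01 := val01 t.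
    have := cx_bounds (f x); have := cx_bounds (h x); nra.
  - move=> [t x]; rewrite /u /=; have t01 := val01 t; have := fh x.
    case: (circle_to_crownP (f x)) => h1 h2;
      case: (circle_to_crownP (h x)) => h3 h4 // _.
    + by split=> // _; rewrite h1 h3; ring.
    + by split=> // e; exfalso; rewrite h1 h3 in e; lra.
    + split=> // e; exfalso.
      by have [/andP[_ h5] /andP[_ h6]] := (h1, h3); have := convex_lt t01 h5 h6; lra.
    + split=> // e; exfalso.
      by have [/andP[_ h5] /andP[_ h6]] := (h1, h3); have := convex_lt t01 h5 h6; lra.
  - move=> [t x]; rewrite /u /=; have t01 := val01 t; have := fh x.
    case: (circle_to_crownP (f x)) => h1 h2;
      case: (circle_to_crownP (h x)) => h3 h4 // _.
    + by split=> // e; exfalso; rewrite h1 h3 in e; lra.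
    + by split=> // _; rewrite h1 h3; ring.
    + split=> // e; exfalso.
      by have [/andP[h5 _] /andP[h6 _]] := (h1, h3); have := convex_gt t01 h5 h6; lra.
    + split=> // e; exfalso.
      by have [/andP[h5 _] /andP[h6 _]] := (h1, h3); have := convex_gt t01 h5 h6; lra.
have [H [cH qH cxH]] := over_crown_lift cG ov.
exists H; split => //.
- by move=> x; apply: circle_to_crown_inj; rewrite ?qH// cxH /u /= val_zero; ring.
- by move=> x; apply: circle_to_crown_inj; rewrite ?qH// cxH /u /= val_one; ring.
- by move=> t x e; apply: circle_to_crown_inj; rewrite ?qH// cxH /u /= e; ring.
Qed.

(* The lift is prescribed on the zero set of [b]. *)
Lemma relative_lift n (g : I * cube R n -> crown_space) (b : I * cube R n -> R)
    (x0 : S1) : continuous g -> continuous b -> (forall p, 0 <= b p) ->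
  (forall p, b p = 0 -> g p = q x0) ->
  exists h : I * cube R n -> S1,
    [/\ continuous h, forall p, q (h p) = g p & forall p, b p = 0 -> h p = x0].
Proof.
move=> cg cb b0 gb.
have cl (c : crown) : (forall y : crown, (c <= y)%O -> y = c) ->
    closed [set p | g p = c :> crown].
  move=> maxc; rewrite (_ : mkset _ = ~` (g @^-1` [set y | y <> c :> crown])).
    apply: open_closedC; move/continuousP: cg; apply.
    apply: crown_open => x y /= yx xc yc.
    by apply: xc; apply: maxc; rewrite -yc.
  by rewrite eqEsubset; split=> p /=; [move=> -> []|move/contrapT].
have max1 (y : crown) : (A1 <= y)%O -> y = A1 by case: y.
have max2 (y : crown) : (A2 <= y)%O -> y = A2 by case: y.
have [f1 [cf1 f1_ge0 f1P]] := cube_closed_zero_set (cl _ max1).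
have [f2 [cf2 f2_ge0 f2P]] := cube_closed_zero_set (cl _ max2).
have f1E p : f1 p = 0 <-> g p = A1 := f1P p.
have f2E p : f2 p = 0 <-> g p = A2 := f2P p.
have f12 p : 0 < f1 p + f2 p.
  rewrite lt_neqAle addr_ge0// andbT eq_sym paddr_eq0//.
  apply/negP => /andP[/eqP/f1E h1 /eqP/f2E h2].
  by have : A1 = A2 := etrans (esym h1) h2.
(* A Urysohn function, equal to 1 exactly where [f1] vanishes and to -1 exactly where [f2] does. *)
pose u p := (f2 p + - f1 p) * (f1 p + f2 p)^-1.
have cu : continuous u.
  have ci : continuous (fun p => (f1 p + f2 p)^-1).
    by apply: invf_continuous => [|p]; [continuity|rewrite gt_eqF].
  by rewrite /u; continuity.
have us p : u p * (f1 p + f2 p) = f2 p - f1 p by rewrite /u mulfVK// gt_eqF.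
have u1 p : -1 <= u p <= 1.
  have h1 := f1_ge0 p; have h2 := f2_ge0 p.
  by apply/andP; split; rewrite -(ler_pM2r (f12 p)) us; lra.
have uA1 p : u p = 1 <-> g p = A1.
  rewrite -(f1E p); have us' := us p; have s0 := f12 p; split => e.
    by rewrite e in us'; lra.
  have n0 : f1 p + f2 p != 0 by rewrite gt_eqF.
  by apply: (mulIf n0); rewrite us e; ring.
have uA2 p : u p = -1 <-> g p = A2.
  rewrite -(f2E p); have us' := us p; have s0 := f12 p; split => e.
    by rewrite e in us'; lra.
  have n0 : f1 p + f2 p != 0 by rewrite gt_eqF.
  by apply: (mulIf n0); rewrite us e; ring.
suff [v ov vx0] : exists2 v, over_crown g v & forall p, b p = 0 -> v p = cx x0.
  have [h [ch qh cxh]] := over_crown_lift cg ov.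
  exists h; split => // p bp.
  by apply: circle_to_crown_inj; rewrite ?qh ?cxh; [exact: gb|exact: vx0].
(* If [x0] lies over [A1] or [A2], then [u] already has the required value on the zeros of [b];
   otherwise it must be blended with the constant [cx x0]. *)
have [[] [x1 gA]|[x1 [nA1 nA2]]] :
    ((cx x0 = 1 /\ q x0 = A1) \/ (cx x0 = -1 /\ q x0 = A2)) \/
    (-1 < cx x0 < 1 /\ q x0 <> A1 /\ q x0 <> A2).
  by case: circle_to_crownP; [left; left|left; right|right|right].
- by exists u => // p bp; rewrite x1; apply/uA1; rewrite gb// gA.
- by exists u => // p bp; rewrite x1; apply/uA2; rewrite gb// gA.
have m0 p : 0 < b p + f1 p * f2 p.
  have bf : 0 <= f1 p * f2 p by rewrite mulr_ge0.
  rewrite lt_neqAle addr_ge0// andbT eq_sym paddr_eq0//.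
  apply/negP => /andP[/eqP/gb gp]; rewrite mulf_eq0 => /orP[/eqP/f1E|/eqP/f2E] /=.
    by rewrite gp.
  by rewrite gp.
(* The weight of [u]: it vanishes with [b], and is 1 exactly where [g] is [A1] or [A2], so the blend
   keeps the fibres over 1 and -1. *)
pose l p := b p * (b p + f1 p * f2 p)^-1.
have cl' : continuous l.
  have ci : continuous (fun p => (b p + f1 p * f2 p)^-1).
    by apply: invf_continuous => [|p]; [continuity|rewrite gt_eqF].
  by rewrite /l; continuity.
have ls p : l p * (b p + f1 p * f2 p) = b p by rewrite /l mulfVK// gt_eqF.
have l01 p : 0 <= l p <= 1.
  have bf : 0 <= f1 p * f2 p by rewrite mulr_ge0.
  have bp := b0 p.
  by apply/andP; split; rewrite -(ler_pM2r (m0 p)) ls; lra.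
have l1 p : g p = A1 \/ g p = A2 -> l p = 1.
  move=> gA; have f0 : f1 p * f2 p = 0.
    by case: gA => [/f1E ->|/f2E ->]; rewrite (mul0r, mulr0).
  have b1 : b p != 0 by have := m0 p; rewrite f0 addr0 => ?; rewrite gt_eqF.
  by rewrite /l f0 addr0 divff.
have l1' p : l p = 1 -> g p = A1 \/ g p = A2.
  move=> e; have := ls p; rewrite e mul1r => h.
  have /eqP : f1 p * f2 p = 0 by lra.
  by rewrite mulf_eq0 => /orP[/eqP/f1E|/eqP/f2E]; [left|right].
exists (fun p => l p * u p + (1 + - l p) * cx x0); last first.
  move=> p bp; have -> : l p = 0 by rewrite /l bp mul0r.
  by ring.
split; first by continuity.
- by move=> p; have := u1 p; have := l01 p; nra.
- move=> p; split=> [e|gA]; last first.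
    by rewrite l1 ?(proj2 (uA1 p))//; [ring|left].
  have lp : l p = 1 by have := u1 p; have := l01 p; nra.
  by apply/uA1; rewrite lp in e; lra.
- move=> p; split=> [e|gA]; last first.
    by rewrite l1 ?(proj2 (uA2 p))//; [ring|right].
  have lp : l p = 1 by have := u1 p; have := l01 p; nra.
  by apply/uA2; rewrite lp in e; lra.
Qed.

Definition cube_bump n (s : cube R n) : R :=
  \prod_(i < n) (set_val (s i) * (1 + - set_val (s i))).

Lemma cube_bump_continuous n : continuous (@cube_bump n).
Proof.
apply: continuous_big; first exact: mul_continuous.
have c i : continuous (fun s : cube R n => set_val (s i) : R).
  by apply: set_valf_continuous; exact: Defs.coord_continuous.
move=> i _; apply: mulf_continuous; first exact: c.
by apply: addf_continuous; [exact: const_continuous|exact: oppf_continuous (c i)].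
Qed.

Lemma cube_bump_ge0 n (s : cube R n) : 0 <= cube_bump s.
Proof.
by apply: prodr_ge0 => i _; have := val01 (s i) => ?; rewrite mulr_ge0//; lra.
Qed.

Lemma cube_bump_eq0 n (s : cube R n) : cube_bump s = 0 <-> cube_boundary s.
Proof.
split=> [/eqP|[i si]].
  rewrite /cube_bump prodf_seq_eq0 => /hasP[i _ /= /eqP h]; exists i.
  move/eqP: h; rewrite mulf_eq0 => /orP[] /eqP h; [left|right];
    apply: set_val_inj; rewrite ?val_zero ?val_one; lra.
rewrite /cube_bump (bigD1 i)//=; case: si => ->; rewrite ?val_zero ?val_one.
  by rewrite !mul0r.
by rewrite subrr mulr0 mul0r.
Qed.

Lemma lift_rel_boundary n (g : I * cube R n -> crown_space) (x0 : S1) :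
  continuous g -> (forall t s, cube_boundary s -> g (t, s) = q x0) ->
  exists h : I * cube R n -> S1, [/\ continuous h, forall p, q (h p) = g p &
    forall t s, cube_boundary s -> h (t, s) = x0].
Proof.
move=> cg gb.
have cb : continuous (fun p : I * cube R n => cube_bump p.2).
  by apply: (comp_continuous _ (@cube_bump_continuous n)); continuity.
have [||h [ch qh hb]] := @relative_lift n g (fun p => cube_bump p.2) x0 cg cb.
- by move=> p; exact: cube_bump_ge0.
- by move=> [t s] /cube_bump_eq0; exact: gb.
by exists h; split => // t s /cube_bump_eq0 bs; apply: hb.
Qed.

HB.instance Definition _ :=
  isContinuous.Build S1 crown_space q circle_to_crown_continuous.

(** For surjectivity, a loop is lifted as a stationary homotopy and one slice is kept. For
    injectivity, a homotopy between the image loops is lifted. *)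
Lemma circle_to_crown_weak_equivalence :
  weak_homotopy_equivalence R (q : continuousType S1 crown_space).
Proof.
apply: weak_equivalence_intro.
- move=> y; have [x <-] : exists x, q x = y; last first.
    by exists x; exact: path_joined_refl.
  have h1 : (-1) ^+ 2 + 0 ^+ 2 = 1 :> R by ring.
  have h2 : 0 ^+ 2 + 1 ^+ 2 = 1 :> R by ring.
  have h3 : 0 ^+ 2 + (-1) ^+ 2 = 1 :> R by ring.
  case: y; [exists (circle_one R)|exists (circle_pt h1)|exists (circle_pt h2)
    |exists (circle_pt h3)]; case: circle_to_crownP => // a b;
    exfalso; move: a b; rewrite ?circle_coordE ?cx_circle_pt ?cy_circle_pt; lra.
- by move=> x x' _; exact: path_joined_circle.
- move=> n x0 g.
  have cg : continuous (fun p : I * cube R n.+1 => g p.2).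
    by apply: (comp_continuous _ (@gloop_continuous _ _ _ _ g)); continuity.
  have [|h [ch qh hb]] := @lift_rel_boundary _ _ x0 cg.
    by move=> t s bs; exact: gloop_boundary.
  have chz : continuous (fun s => h (zero, s)).
    by apply: (comp_continuous _ ch); continuity.
  exists (Gloop chz (hb zero)); apply: eq_loop_homotopic => s /=.
  exact: qh.
- move=> n x0 f g /asboolP[H [cH H0 H1 Hb]].
  have [h [ch qh hb]] := lift_rel_boundary cH Hb.
  have cht t : continuous (fun s => h (t, s)).
    by apply: (comp_continuous _ ch); continuity.
  (* The ends of the lifted homotopy lie over the same loops as [f] and [g] but may differ from
     them; fibrewise homotopies correct this. *)
  have fibre (k : gloop R n.+1 x0) t : (forall s, H (t, s) = q (k s)) ->
      loop_homotopic k (Gloop (cht t) (hb t)).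
    move=> Ht; apply/asboolP.
    have [|K [cK K0 K1 Kf]] := fibrewise_homotopy (@gloop_continuous _ _ _ _ k) (cht t).
      by move=> s; rewrite qh Ht.
    exists K; split => // t' s bs.
    by rewrite Kf gloop_boundary// hb.
  apply: (loop_homotopic_trans (fibre f zero H0)).
  rewrite loop_homotopic_sym; apply: (loop_homotopic_trans (fibre g one H1)).
  by rewrite loop_homotopic_sym; apply/asboolP; exists h; split.
Qed.

End CircleToCrown.

(** * The Moebius band and its core *)

Section DeformationRetract.
Variable R : realType.
Local Notation I := (set_type (@unitI R)).

(** As [D] fixes the image of [s] at all times, it deforms a based loop [g] onto the image of its
    retraction while staying based; injectivity follows by applying [p] to homotopies. *)
Lemma deformation_retract_weak_equivalence (A B : topologicalType)
    (s : continuousType A B) (p : B -> A) (D : I * B -> B) :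
  continuous p -> cancel s p -> continuous D ->
  (forall b, D (zero, b) = b) -> (forall b, D (one, b) = s (p b)) ->
  (forall u a, D (u, s a) = s a) -> weak_homotopy_equivalence R s.
Proof.
move=> cp sK cD D0 D1 Ds.
apply: weak_equivalence_intro.
- move=> b; exists (p b); rewrite path_joined_sym; apply/asboolP.
  apply: (@inhabited_path _ _ _ _ (fun u => D (u, b))) => //.
  by apply: (comp_continuous _ cD); continuity.
- move=> x x' /asboolP[g]; apply/asboolP.
  apply: (@inhabited_path _ _ _ _ (fun u => p (g u))).
  + exact: comp_continuous (@cts_fun _ _ g) cp.
  + by rewrite path_zero sK.
  + by rewrite path_one sK.
- move=> n x g.
  have cf : continuous (fun c => p (g c)).
    exact: comp_continuous (@gloop_continuous _ _ _ _ g) cp.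
  have bf (c : cube R n.+1) : cube_boundary c -> p (g c) = x.
    by move=> /(@gloop_boundary _ _ _ _ g) ->; rewrite sK.
  exists (Gloop cf bf); rewrite loop_homotopic_sym; apply/asboolP.
  exists (fun z => D (z.1, g z.2)); split => //=.
  + apply: (comp_continuous _ cD); apply: pair_continuous; first by continuity.
    by apply: (comp_continuous _ (@gloop_continuous _ _ _ _ g)); continuity.
  + by move=> t c /(@gloop_boundary _ _ _ _ g) ->.
- move=> n x f g /asboolP[H [cH H0 H1 Hb]]; apply/asboolP.
  exists (fun z => p (H z)); split.
  + exact: comp_continuous cH cp.
  + by move=> c; rewrite H0 /= sK.
  + by move=> c; rewrite H1 /= sK.
  + by move=> t c /(Hb t) ->; rewrite sK.
Qed.

(** The product of a quotient map with the locally compact interval is again a quotient map: for a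
    compact neighbourhood [N] of the time, the points whose whole [N]-segment is sent into [U] form
    an open set by the tube lemma. *)
Lemma cylinder_quotient_continuous (X Y : topologicalType) (Q : quotType X)
    (F : I * quotient_topology Q -> Y) :
  continuous (fun p : I * X => F (p.1, \pi_(quotient_topology Q) p.2)) ->
  continuous F.
Proof.
move=> cF; apply/continuousP => U oU; rewrite openE => -[u0 m0].
rewrite -(reprK m0); move: (repr m0) => {m0} p0; rewrite /preimage /= => Uu0.
pose G (v : R) := F (clamp v, \pi_(quotient_topology Q) p0).
have cG : continuous G.
  apply: (@comp_continuous _ _ _ (fun v : R => (clamp v, p0)) _ _ cF).
  by continuity.
have /nbhs_ballP[e /= e0 He] : nbhs (set_val u0 : R) (G @^-1` U).
  apply: cG; apply: open_nbhs_nbhs; split => //.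
  by rewrite /G clampK.
(* Half the radius makes the closed neighbourhood fit inside the open ball. *)
pose N := [set u : I | `|set_val u0 - set_val u| <= e / 2].
have cdist : continuous (fun u : I => `|set_val u0 + - set_val u|) by continuity.
have cN : compact N.
  apply: (subclosed_compact _ (@unit_interval_compact R)) => //.
  exact: (preimage_closed (fun u _ => cdist u) (@closed_le _ (e / 2))).
have NU u : N u -> U (F (u, \pi_(quotient_topology Q) p0)).
  move=> Nu; have : (G @^-1` U) (set_val u).
    by apply: He; rewrite /ball /=; apply: le_lt_trans Nu _; lra.
  by rewrite /G /= clampK.
pose S := [set m : quotient_topology Q | forall u, N u -> U (F (u, m))].
have oS : open S.
  suff : open (\pi_(quotient_topology Q) @^-1` S) by [].
  rewrite openE => p Sp; rewrite /interior.
  have /compact_near_coveringP := cN.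
  move=> /(_ _ (nbhs p) (fun p' u => U (F (u, \pi_(quotient_topology Q) p')))).
  apply=> u Nu.
  have : nbhs (u, p) ((fun p : I * X =>
      F (p.1, \pi_(quotient_topology Q) p.2)) @^-1` U).
    by apply: cF; apply: open_nbhs_nbhs; split => //; exact: Sp.
  by [].
exists (N, S) => /=.
  split; last by apply: open_nbhs_nbhs.
  have : \forall u \near u0, `|set_val u0 + - set_val u| < e / 2.
    by apply: (cvgr_lt _ (cdist u0)); rewrite subrr normr0; lra.
  by apply: filterS => u /= /ltW.
by move=> [u m] /= [Nu Sm]; exact: Sm.
Qed.

End DeformationRetract.

(** * The strong deformation retraction of the band onto its core *)

Section Moebius.
Variable R : realType.
Local Notation I := (set_type (@unitI R)).
Local Notation M := (moebius_band R).
Local Notation S1 := (circle R).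

Definition to_moebius (p : I * I) : M := \pi_M p.

Lemma to_moebius_continuous : continuous to_moebius.
Proof. exact: pi_continuous. Qed.

Lemma moebius_rep (m : M) : exists p, m = to_moebius p.
Proof. by exists (repr m); rewrite /to_moebius reprK. Qed.

Lemma to_moebius_eq (Z : Type) (f : I * I -> Z) :
  (forall p p', moebius_glue p p' -> f p = f p') ->
  forall p p', to_moebius p = to_moebius p' -> f p = f p'.
Proof.
move=> fglue p p' e.
have /eqmodP/asboolP : \pi_({eq_quot (moebius_equiv R)}) p =
  \pi_({eq_quot (moebius_equiv R)}) p' := e.
move: e => _; elim=> {p p'} [p p'|//|p p' _ ->//|p p' p'' _ -> _ ->//].
exact: fglue.
Qed.

Lemma to_moebius_glue (p p' : I * I) :
  moebius_glue p p' -> to_moebius p = to_moebius p'.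
Proof.
move=> g; suff : \pi_({eq_quot (moebius_equiv R)}) p =
  \pi_({eq_quot (moebius_equiv R)}) p' by [].
by apply/eqmodP/asboolP; exact: rst_step.
Qed.

Definition midpoint : I := clamp (2^-1).

Lemma val_midpoint : set_val midpoint = 2^-1.
Proof. by rewrite val_clamp//; apply/andP; split; lra. Qed.

(** One turn around the circle, with abscissa 1 - 4x on the upper half and 4x - 3 on the lower
    half. *)
Definition circle_loop (x : I) : S1 :=
  if set_val x <= 2^-1 then half_circle (clamp (2 * set_val x))
  else circle_conj (half_circle (clamp (2 + - (2 * set_val x)))).

Lemma circle_loop_ge (x : I) : 2^-1 <= set_val x ->
  circle_loop x = circle_conj (half_circle (clamp (2 + - (2 * set_val x)))).
Proof.
rewrite /circle_loop => x1; case: ifP => // x2.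
rewrite !clamp_ge1; [|lra|lra].
by apply: circle_ext; rewrite !circle_coordE// cy_half_circle1 oppr0.
Qed.

Lemma circle_loop_continuous : continuous circle_loop.
Proof.
have c1 : continuous (fun x : I => half_circle (clamp (2 * set_val x))).
  by apply: (comp_continuous _ (@half_circle_continuous R)); continuity.
have c2 : continuous (fun x : I =>
    circle_conj (half_circle (clamp (2 + - (2 * set_val x))))).
  apply: circle_conjf_continuous.
  by apply: (comp_continuous _ (@half_circle_continuous R)); continuity.
have cv : continuous (fun x : I => set_val x : R) by continuity.
apply: (closed_cover_continuous
  (preimage_closed (fun x _ => cv x) (@closed_le _ 2^-1))
  (preimage_closed (fun x _ => cv x) (@closed_ge _ 2^-1)) _ c1 c2).
- by move=> x /=; apply/orP; exact: le_total.
- by move=> x /= xh; rewrite /circle_loop xh.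
- by move=> x /= xh; rewrite circle_loop_ge.
Qed.

(** The two formulas invert the two branches of [circle_loop] along the middle line. *)
Definition core (p : S1) : M :=
  if 0 <= cy p then to_moebius (clamp ((1 + - cx p) / 4), midpoint)
  else to_moebius (clamp ((3 + cx p) / 4), midpoint).

(** On the axis the two formulas agree: both give 1/2 at abscissa -1, while at abscissa 1 they give
    0 and 1, which are glued at height 1/2. *)
Lemma core_le0 (p : S1) : cy p <= 0 ->
  core p = to_moebius (clamp ((3 + cx p) / 4), midpoint).
Proof.
rewrite /core => y0; case: ifP => // y1.
have y : cy p = 0 by lra.
have : (cx p - 1) * (cx p + 1) = 0.
  by transitivity (cx p ^+ 2 + cy p ^+ 2 - 1); [rewrite y; ring|rewrite circleP subrr].
move=> /eqP; rewrite mulf_eq0 => /orP[] /eqP h.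
  have -> : cx p = 1 by lra.
  rewrite clamp_le0; last lra. rewrite clamp_ge1; last lra.
  by apply: to_moebius_glue; split => //=; rewrite val_midpoint; lra.
have -> : cx p = -1 by lra.
by congr (to_moebius (clamp _, _)); lra.
Qed.

Lemma core_continuous : continuous core.
Proof.
have cid : continuous (fun p : S1 => p) by exact: id_continuous.
have ccx := cxf_continuous cid; have ccy := cyf_continuous cid.
have c1 : continuous (fun p : S1 => to_moebius (clamp ((1 + - cx p) / 4), midpoint)).
  by apply: (comp_continuous _ to_moebius_continuous); continuity.
have c2 : continuous (fun p : S1 => to_moebius (clamp ((3 + cx p) / 4), midpoint)).
  by apply: (comp_continuous _ to_moebius_continuous); continuity.
apply: (closed_cover_continuous
  (preimage_closed (fun x _ => ccy x) (@closed_ge _ 0))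
  (preimage_closed (fun x _ => ccy x) (@closed_le _ 0)) _ c1 c2).
- by move=> x /=; apply/orP; exact: le_total.
- by move=> x /= xh; rewrite /core xh.
- by move=> x /= xh; rewrite core_le0.
Qed.

Lemma core_circle_loop x : core (circle_loop x) = to_moebius (x, midpoint).
Proof.
have x01 := val01 x; have [xh|xh] := leP (set_val x) 2^-1.
  rewrite /circle_loop xh /core cy_half_circle sqrtr_ge0 cx_half_circle.
  rewrite val_clamp; last by apply/andP; split; lra.
  by rewrite -[x in RHS]clampK; congr (to_moebius (clamp _, _)); field.
rewrite circle_loop_ge ?ltW// core_le0 ?circle_coordE; last first.
  by rewrite oppr_le0 cy_half_circle sqrtr_ge0.
rewrite cx_half_circle val_clamp; last by apply/andP; split; lra.
by rewrite -[x in RHS]clampK; congr (to_moebius (clamp _, _)); field.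
Qed.

Definition moebius_to_circle (m : M) : S1 := circle_loop (repr m).1.

Lemma circle_loop_glue (p p' : I * I) :
  moebius_glue p p' -> circle_loop p.1 = circle_loop p'.1.
Proof.
move=> [-> -> _]; rewrite [RHS]circle_loop_ge ?val_one; last by lra.
rewrite /circle_loop val_zero ifT; last by lra.
rewrite clamp_le0; last lra. rewrite clamp_le0; last lra.
by rewrite half_circle0; apply: circle_ext; rewrite !circle_coordE ?oppr0.
Qed.

Lemma moebius_to_circleE p : moebius_to_circle (to_moebius p) = circle_loop p.1.
Proof.
apply: (to_moebius_eq (f := fun p => circle_loop p.1)) => [|].
  exact: circle_loop_glue.
by rewrite /to_moebius reprK.
Qed.

Lemma moebius_to_circle_continuous : continuous moebius_to_circle.
Proof.
apply/quotient_continuous.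
rewrite (_ : _ \o _ = fun p => circle_loop p.1).
  by apply: (comp_continuous _ circle_loop_continuous); continuity.
by apply/funext => p; exact: moebius_to_circleE.
Qed.

Lemma coreK : cancel core moebius_to_circle.
Proof.
move=> p; have pb := cx_bounds p.
have y2 : Num.sqrt (1 - cx p ^+ 2) = `|cy p|.
  by rewrite -(circleP p) addrAC subrr add0r sqrtr_sqr.
have [y0|y0] := leP 0 (cy p).
  rewrite /core y0 moebius_to_circleE /circle_loop /=.
  rewrite val_clamp; last by apply/andP; split; lra.
  rewrite ifT; last by lra.
  have e : 1 - 2 * (2 * ((1 + - cx p) / 4)) = cx p by field.
  apply: circle_ext; rewrite ?cx_half_circle ?cy_half_circle val_clamp ?e//;
    try (by apply/andP; split; lra).
  by rewrite y2 ger0_norm.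
rewrite core_le0 ?ltW// moebius_to_circleE circle_loop_ge /=.
  rewrite val_clamp; last by apply/andP; split; lra.
  have e : 1 - 2 * (2 + - (2 * ((3 + cx p) / 4))) = cx p by field.
  apply: circle_ext; rewrite !circle_coordE ?cx_half_circle ?cy_half_circle
    val_clamp ?e//;
    try (by apply/andP; split; lra).
  by rewrite y2 ltr0_norm// opprK.
by rewrite val_clamp; [|apply/andP; split]; lra.
Qed.

Definition squeeze (u : I) (p : I * I) : I * I :=
  (p.1, clamp ((1 + - set_val u) * set_val p.2 + set_val u * 2^-1)).

Lemma squeeze_bounds (u t : R) : 0 <= u <= 1 -> 0 <= t <= 1 ->
  0 <= (1 + - u) * t + u * 2^-1 <= 1.
Proof.
move=> /andP[u0 u1] /andP[t0 t1].
have h1 : 0 <= (1 - u) * t by rewrite mulr_ge0//; lra.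
have h2 : 0 <= (1 - u) * (1 - t) by rewrite mulr_ge0//; lra.
by apply/andP; split; lra.
Qed.

Definition moebius_squeeze (z : I * M) : M := to_moebius (squeeze z.1 (repr z.2)).

(** Interpolation towards height 1/2 commutes with the flip of the gluing, which fixes 1/2. *)
Lemma moebius_squeezeE u p :
  moebius_squeeze (u, to_moebius p) = to_moebius (squeeze u p).
Proof.
apply: (to_moebius_eq (f := fun p => to_moebius (squeeze u p))); last first.
  by rewrite /to_moebius reprK.
move=> {}p p' [p1 p1' p2]; apply: to_moebius_glue; split => //=.
rewrite !val_clamp ?p2; first by field.
  by have := squeeze_bounds (val01 u) (val01 p.2).
by rewrite -p2; exact: squeeze_bounds (val01 u) (val01 p'.2).
Qed.

Lemma moebius_squeeze_continuous : continuous moebius_squeeze.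
Proof.
apply: cylinder_quotient_continuous.
rewrite (_ : (fun p => _) = fun p : I * (I * I) => to_moebius (squeeze p.1 p.2)).
  by apply: (comp_continuous _ to_moebius_continuous); rewrite /squeeze; continuity.
by apply/funext => -[u p]; exact: moebius_squeezeE.
Qed.

HB.instance Definition _ := isContinuous.Build S1 M core core_continuous.

Lemma core_weak_equivalence :
  weak_homotopy_equivalence R (core : continuousType S1 M).
Proof.
apply: (deformation_retract_weak_equivalence (p := moebius_to_circle)
  (D := moebius_squeeze)).
- exact: moebius_to_circle_continuous.
- exact: coreK.
- exact: moebius_squeeze_continuous.
- move=> m; have [[x t] ->] := moebius_rep m; rewrite moebius_squeezeE.
  congr to_moebius; congr pair => /=.
  by rewrite val_zero oppr0 addr0 mul1r mul0r addr0 clampK.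
- move=> m; have [[x t] ->] := moebius_rep m.
  rewrite moebius_squeezeE moebius_to_circleE /= core_circle_loop.
  by congr (to_moebius (_, clamp _)); rewrite /= val_one subrr mul0r mul1r add0r.
- move=> u p /=; have [x ->] : exists x, core p = to_moebius (x, midpoint).
    by rewrite /core; case: ifP => _; eexists.
  rewrite moebius_squeezeE; congr to_moebius; congr pair => /=.
  by rewrite val_midpoint -mulrDl subrK mul1r.
Qed.

End Moebius.

(** * Finite models *)

Lemma set_inj_card_le (T U : Type) (A : set T) (B : set U) (f : T -> U) :
  set_fun A B f -> set_inj A f -> A #<= B.
Proof.
move=> fAB finj; have [g] : $|{injfun A >-> B}| by apply/injfunPex; exists f.
exact: inj_card_le g.
Qed.

Lemma card_leT_inj (T U : Type) : [set: T] #<= [set: U] ->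
  exists f : T -> U, injective f.
Proof.
move=> /card_leP[f]; exists (fun x => val (f (SigSub (mem_set (I : setT x))))).
move=> x y /val_inj /(@inj _ _ _ f) h.
by have /(congr1 val) := h (mem_set I) (mem_set I).
Qed.

Section FiniteModels.
Variable R : realType.

Lemma weakly_equivalent_trans (X Y Z : topologicalType) :
  weakly_equivalent R X Y -> weakly_equivalent R Y Z -> weakly_equivalent R X Z.
Proof. exact: rst_trans. Qed.

Lemma circle_crown_equivalent : weakly_equivalent R (circle R) crown_space.
Proof. by apply: rst_step; eexists; exact: circle_to_crown_weak_equivalence. Qed.

Lemma circle_moebius_equivalent : weakly_equivalent R (circle R) (moebius_band R).
Proof. by apply: rst_step; eexists; exact: core_weak_equivalence. Qed.

Lemma crown_circle_model : finite_model R crown_space (circle R).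
Proof.
split; first exact: finite_finset.
by apply: rst_sym; exact: circle_crown_equivalent.
Qed.

Lemma finite_model_moebius (Z : topologicalType) :
  finite_model R Z (moebius_band R) <-> finite_model R Z (circle R).
Proof.
have e := circle_moebius_equivalent; split=> -[fZ eZ]; split=> //.
  by apply: weakly_equivalent_trans eZ _; exact: rst_sym.
exact: weakly_equivalent_trans eZ e.
Qed.

(** The invariants of the circle exclude the simply connected alternative. This yields both the
    minimality of the crown and its uniqueness. *)
Lemma small_circle_model (Z : topologicalType) : finite_model R Z (circle R) ->
  [set: Z] #<= [set: crown] -> homeomorphic Z crown_space.
Proof.
move=> [fZ /weakly_equivalent_invariants[pc tr]] leZ.
have pZ : path_connected R Z by apply/pc; exact: path_connected_circle.
have [f fsurj] : exists f : crown -> Z, forall z, exists x, f x = z.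
  have [z0 _] := pZ.
  have [g ginj] := card_leT_inj leZ.
  (* A left inverse of [g], extended by the default point [z0]. *)
  pose f c := if pselect (exists z, g z = c) is left h then projT1 (cid h) else z0.
  exists f => z; exists (g z); rewrite /f; case: pselect => [h|[]]; last by exists z.
  by case: cid => z' /= /ginj.
have [//|triv] := small_space_dichotomy fZ fsurj pZ.
by have := @circle_pi1_nontrivial R; case; apply/tr.
Qed.

Lemma card_crown : [set: crown] #= `I_4.
Proof.
apply/card_eqPle; split.
  apply: (@set_inj_card_le _ _ _ _ (fun c => index c crown_points)).
    by case.
  by do 2!case.
apply: (@set_inj_card_le _ _ _ _ (nth A1 crown_points)) => //.
by move=> x y; rewrite !inE /= => x4 y4 /eqP; rewrite nth_uniq// => /eqP.
Qed.

(** A model with fewer than four points would still be homeomorphic to the crown, and this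
    homeomorphism already gives the required injection. *)
Lemma minimal_circle_model (Z : topologicalType) : finite_model R Z (circle R) ->
  [set: crown_space] #<= [set: Z].
Proof.
move=> mZ; have [n Zn] := mZ.1.
have [n4|n4] := leqP 4%N n.
  by rewrite (card_le_eql card_crown) (card_le_eqr Zn) card_le_II.
have leZ : [set: Z] #<= [set: crown].
  by rewrite (card_le_eql Zn) (card_le_eqr card_crown) card_le_II ltnW.
have [f [g [_ _ fK gK]]] := small_circle_model mZ leZ.
by apply: (@set_inj_card_le _ _ _ _ g) => // x y _ _; exact: (can_inj gK).
Qed.

End FiniteModels.

Theorem mainTheorem1 (R : realType) :
  (exists Y : topologicalType,
     [/\ minimal_finite_model R Y (moebius_band R),
         [set: Y] #= `I_4 &
         homeomorphic Y crown_space]) /\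
  minimal_finite_model R crown_space (circle R) /\
  (forall Z : topologicalType,
     minimal_finite_model R Z (circle R) -> homeomorphic Z crown_space).
Proof.
have crown_min : minimal_finite_model R crown_space (circle R).
  by split; [exact: crown_circle_model|exact: minimal_circle_model].
split; [|split] => //.
- exists crown_space; split; [split|exact: card_crown|].
  + by apply/finite_model_moebius; exact: crown_circle_model.
  + by move=> Z /finite_model_moebius; exact: minimal_circle_model.
  + by exists id, id; split => //; exact: id_continuous.
- move=> Z [mZ minZ]; apply: (small_circle_model mZ).
  exact: (minZ crown_space (crown_circle_model R)).
Qed.
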